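(* Let $n \geq 2$ be an integer and let $f : [0,\infty) \to [0,\infty)$ be a $C^{n-1}$ function satisfying: $f(x) > 0$ for all $x > 0$; $\lim_{x \to 0^+} f(x) > 0$; and for all integers $0 < i < n$, $f^{(i)}(x) \geq 0$ for all $x > 0$ and $\lim_{x \to 0^+} f^{(i)}(x) = M_i < \infty$. Then the set of real values $\alpha \geq 0$ such that the function $x \mapsto x^\alpha f(x)$ preserves $DN_n$ (that is, $A^\alpha f(A) \in DN_n$ for all $A \in DN_n$) is exactly $\mathbb{N} \cup [n-2,\infty)$, where $\mathbb{N} = \{0,1,2,\dots\}$. In particular, the critical exponent of every such $f$ is $m(f,n) = n-2$.
   Context: A real symmetric $n \times n$ matrix is doubly nonnegative if it is both positive semidefinite and entrywise nonnegative; $DN_n$ denotes the set of all such matrices. For $h : [0,\infty) \to [0,\infty)$ and $A \in DN_n$ with spectral decomposition $A = U D U^T$ ($U$ real orthogonal, $D = \mathrm{diag}(d_{11},\dots,d_{nn})$), the matrix $h(A)$ is defined by $h(A) := U\,\mathrm{diag}(h(d_{11}),\dots,h(d_{nn}))\,U^T$. In particular $A^\alpha$ for real $\alpha \geq 0$ is $h(A)$ with $h(x) = x^\alpha$ (with $0^0 = 1$), and $A^\alpha f(A)$ equals $g(A)$ for $g(x) = x^\alpha f(x)$. The critical exponent of $f : [0,\infty) \to [0,\infty)$ is $$m(f,n) := \inf\{\, t \in \mathbb{R},\ t \geq 0 \ : \ A^\alpha f(A) \in DN_n \text{ for all } A \in DN_n \text{ and all real } \alpha \geq t \,\}.$$ 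*)

(* Defs.v *)
From HB Require Import structures.
From mathcomp Require Import all_boot all_order all_algebra.
From mathcomp Require Import all_classical all_reals all_analysis.

Set Implicit Arguments.
Unset Strict Implicit.
Unset Printing Implicit Defensive.

Import Order.TTheory GRing.Theory Num.Theory.
Import numFieldNormedType.Exports.

Local Open Scope classical_set_scope.
Local Open Scope ring_scope.

(* Functions on [0, +oo[ are represented by functions R -> R of which only the
   values on [0, +oo[ matter. *)

(* f is of class C^k on the closed half-line: g i is the i-th derivative of f,
   one-sided at 0. *)
Definition class_C_nneg (R : realType) (k : nat) (f : R -> R) : Prop :=
  exists g : nat -> R -> R,
    [/\ forall x, 0 <= x -> g 0%N x = f x,
        forall i x, (i < k)%N -> 0 <= x ->
          (g i y - g i x) / (y - x) @[y --> within `[0, +oo[ x^'] --> g i.+1 x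
      & forall i, (i <= k)%N -> {within `[0, +oo[, continuous (g i)}].

Definition psdmx (R : realType) (n : nat) (A : 'M[R]_n) : Prop :=
  A^T = A /\ forall v : 'cV[R]_n, 0 <= (v^T *m A *m v) ord0 ord0.

Definition DN (R : realType) (n : nat) : set 'M[R]_n :=
  [set A | psdmx A /\ forall i j, 0 <= A i j].

Arguments DN {R} n _.

Definition orthogonalmx (R : realType) (n : nat) (U : 'M[R]_n) : Prop :=
  U *m U^T = 1%:M.

(* The value does not depend on the chosen decomposition, see matfunE. The
   default 0 is never used for symmetric A, by the spectral theorem. *)
Definition matfun (R : realType) (n : nat) (h : R -> R) (A : 'M[R]_n) : 'M[R]_n :=
  xget 0 [set B | exists (U : 'M[R]_n) (d : 'rV[R]_n),
    [/\ orthogonalmx U, A = U *m diag_mx d *m U^T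
      & B = U *m diag_mx (map_mx h d) *m U^T]].

Lemma matfunE (R : realType) (n : nat) (h : R -> R) (U : 'M[R]_n) (d : 'rV[R]_n) :
  orthogonalmx U ->
  matfun h (U *m diag_mx d *m U^T) = U *m diag_mx (map_mx h d) *m U^T.
Proof.
move=> oU; apply: xget_unique; first by exists U, d.
move=> B [V [e [oV UV ->]]].
have oU' : U^T *m U = 1%:M by exact: mulmx1C.
have oV' : V^T *m V = 1%:M by exact: mulmx1C.
pose W := V^T *m U.
have VW : V *m W = U by rewrite /W mulmxA oV mul1mx.
have WU : W *m U^T = V^T by rewrite /W -mulmxA oU mulmx1.
have eW : W *m diag_mx d = diag_mx e *m W.
  have := congr1 (fun X => V^T *m X *m U) UV.
  by rewrite /W !mulmxA oV' mul1mx -!mulmxA oU' mulmx1.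
have hW : W *m diag_mx (map_mx h d) = diag_mx (map_mx h e) *m W.
  apply/matrixP=> i j; have := congr1 (fun X : 'M[R]_n => X i j) eW.
  rewrite !mul_mx_diag !mul_diag_mx !mxE mulrC => /eqP.
  rewrite -subr_eq0 -mulrBl mulf_eq0 => /orP[ | /eqP ->].
    by rewrite subr_eq0 => /eqP ->; rewrite mulrC.
  by rewrite mulr0 mul0r.
by rewrite -WU mulmxA -(mulmxA V) -hW mulmxA VW.
Qed.

(* A^alpha f(A) is matfun (pow_mul alpha f) A; note that 0 `^ 0 = 1. *)
Definition pow_mul (R : realType) (alpha : R) (f : R -> R) : R -> R :=
  fun x => x `^ alpha * f x.

Definition preserves_DN (R : realType) (n : nat) (h : R -> R) : Prop :=
  forall A : 'M[R]_n, DN n A -> DN n (matfun h A).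

(* The infimum is taken in the extended reals, where inf set0 = +oo; the real
   infimum of set0 would be 0. *)
Definition critical_exponent (R : realType) (f : R -> R) (n : nat) : \bar R :=
  ereal_inf [set t%:E | t in [set t : R | 0 <= t /\
    forall (A : 'M[R]_n) (alpha : R), DN n A -> t <= alpha ->
      DN n (matfun (pow_mul alpha f) A)]].

(* Main.v *)
Require Import Defs.
From mathcomp Require Import all_boot all_order all_algebra.
From mathcomp Require Import all_classical all_reals all_analysis.
From mathcomp Require Import perm complex.
From mathcomp Require Import ring lra zify.
Import Order.TTheory GRing.Theory Num.Theory.
Import numFieldNormedType.Exports.
Local Open Scope classical_set_scope.
Local Open Scope ring_scope.

(** Write [h x = x `^ a * f x] and diagonalize a doubly
    nonnegative [A], with eigenvalues [lam 0 <= lam 1 <= ...] and orthonormal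
    eigenvectors the columns of [U]. Entry [(i, j)] of [h(A)] is the value at
    [h] of the linear functional [L h = \sum_l U i l * U j l * h (lam l)], and
    Newton's interpolation formula expands it as
    [\sum_k h[lam 0, ..., lam k] * p_k(A) i j], where [p_k] is the product of
    the [x - lam m] for [m < k].

    If [a] is a natural number or [n - 2 <= a], both [x `^ a] and [f] have
    nonnegative derivatives of all orders below [n] on the positive half-line,
    hence so has [h] ([nonneg_derivsM]), and its divided differences are
    nonnegative by an iterated Rolle theorem ([newton_coef_mvt]). The matrices
    [p_k(A)] are entrywise nonnegative as well: this is the theorem of
    Micchelli and Willoughby ([micchelli_willoughby]), proved by induction on
    the size. Deleting row and column [j] of [A] leaves a matrix [B] whose
    eigenvalues [mu] interlace those of [A]; column [j] of the adjugate of
    ['X - A] is both [\sum_k p_k(A) * \prod_(m > k) ('X - lam m)] and, off the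
    diagonal, the analogous sum for [B] applied to the deleted column, and
    interlacing expresses each [\prod_(m > k) ('X - mu m)] as a nonnegative
    combination of the [\prod_(m > k) ('X - lam m)]. Repeated eigenvalues and
    the bad behaviour of [h] at 0 are dealt with by moving the nodes
    ([newton_functional_ge0]).

    If [a] lies strictly between [K] and [K + 1] with [K + 3 <= n], take for [A]
    a small multiple of a tridiagonal matrix of size [K + 3], padded with zeros.
    Its corner entry functional kills the polynomials of degree below [K + 2],
    so on [x `^ a] it is a positive multiple of a divided difference of order
    [K + 2], whose sign is that of [a * (a - 1) * ... * (a - K - 1) < 0]
    ([path_mx_powR_lt0]); near 0 the factor [f] is close to the constant
    [f 0 > 0] and does not change this sign. *)

Set Implicit Arguments.
Unset Strict Implicit.
Unset Printing Implicit Defensive.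

(** * Diagonalization of real symmetric matrices *)

(** A complex eigenvector [x + i y] exists for some eigenvalue [a + i b];
    comparing [x A y^T] with [y A x^T] gives [b (|x|^2 + |y|^2) = 0], so the
    eigenvalue is real and [x] or [y] is a real eigenvector. *)
Lemma symmx_eigenvector (R : realType) n (A : 'M[R]_n.+1) : A^T = A ->
  exists a (v : 'rV[R]_n.+1), v != 0 /\ v *m A = a *: v.
Proof.
move=> sA; pose f := real_complex R.
have [[a b] /eigenvalueP[v vA v0]] :=
  @eigenvalue_closed R[i] n.+1 (map_mx f A) isT.
pose x := map_mx (@complex.Re R) v; pose y := map_mx (@complex.Im R) v.
have xA : x *m A = a *: x - b *: y.
  apply/rowP => j; have /rowP/(_ j) := vA; rewrite !mxE => /(congr1 (@complex.Re R)).
  have -> : complex.Re ((a +i* b)%C * v 0 j) = a * x 0 j - b * y 0 j.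
    by rewrite /x /y !mxE; case: (v 0 j).
  rewrite !mxE => <-; rewrite raddf_sum; apply: eq_bigr => k _.
  by rewrite !mxE; case: (v 0 k) => p q /=; rewrite mulr0 subr0.
have yA : y *m A = b *: x + a *: y.
  apply/rowP => j; have /rowP/(_ j) := vA; rewrite !mxE => /(congr1 (@complex.Im R)).
  have -> : complex.Im ((a +i* b)%C * v 0 j) = b * x 0 j + a * y 0 j.
    by rewrite /x /y !mxE; case: (v 0 j) => p q /=; rewrite addrC.
  rewrite !mxE => <-; rewrite raddf_sum; apply: eq_bigr => k _.
  by rewrite !mxE; case: (v 0 k) => p q /=; rewrite mulr0 add0r.
have normE (w : 'rV[R]_n.+1) : (w *m w^T) 0 0 = \sum_j w 0 j ^+ 2.
  by rewrite mxE; apply: eq_bigr => j _; rewrite mxE expr2.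
have norm_ge0 (w : 'rV[R]_n.+1) : 0 <= (w *m w^T) 0 0.
  by rewrite normE sumr_ge0 // => j _; exact: sqr_ge0.
have norm_eq0 (w : 'rV[R]_n.+1) : (w *m w^T) 0 0 = 0 -> w = 0.
  rewrite normE => /eqP; rewrite psumr_eq0 => [/allP w0|j _]; last exact: sqr_ge0.
  apply/rowP => j; rewrite mxE; apply/eqP; rewrite -sqrf_eq0.
  exact: (w0 j (mem_index_enum _)).
have trE (p : 'M[R]_1) : p^T 0 0 = p 0 0 by rewrite mxE.
have xyC : (x *m y^T) 0 0 = (y *m x^T) 0 0.
  by rewrite -(trE (y *m x^T)) trmx_mul trmxK.
have b_norm : b * ((x *m x^T) 0 0 + (y *m y^T) 0 0) = 0.
  have : (x *m A *m y^T) 0 0 = (y *m A *m x^T) 0 0.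
    by rewrite -(trE (y *m A *m x^T)) !trmx_mul sA trmxK mulmxA.
  rewrite xA yA mulmxBl mulmxDl -!scalemxAl.
  have E (p q : 'M[R]_1) : (p + q) 0 0 = p 0 0 + q 0 0 by rewrite mxE.
  have EN (p : 'M[R]_1) : (- p) 0 0 = - p 0 0 by rewrite mxE.
  have EZ c (p : 'M[R]_1) : (c *: p) 0 0 = c * p 0 0 by rewrite mxE.
  rewrite !E EN !EZ xyC => h; lra.
have {}v0 : (x != 0) || (y != 0).
  apply: contraNT v0; rewrite negb_or !negbK => /andP[/eqP x0 /eqP y0].
  apply/eqP/rowP => j; have /rowP/(_ j) := x0; have /rowP/(_ j) := y0.
  by rewrite !mxE; case: (v 0 j) => p q /= -> ->.
have b0 : b = 0.
  apply/eqP; have /eqP := b_norm; rewrite mulf_eq0 => /orP[//|].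
  rewrite paddr_eq0 // => /andP[/eqP/norm_eq0 x0 /eqP/norm_eq0 y0].
  by move: v0; rewrite x0 y0 eqxx.
rewrite b0 !scale0r subr0 add0r in xA yA.
by case/orP: v0 => [x0|y0]; [exists a, x|exists a, y].
Qed.

(** The witness is the reflection exchanging [v] and the first basis vector
    [e]; it is defined by [v - e], which vanishes only if the identity works. *)
Lemma householder (R : realType) n (v : 'cV[R]_n.+1) : v^T *m v = 1%:M ->
  exists2 H : 'M[R]_n.+1, orthogonalmx H & H *m delta_mx 0 0 = v.
Proof.
move=> v1; pose e : 'cV[R]_n.+1 := delta_mx 0 0; pose c := 1 - v 0 0.
pose w := v - e.
have E : v^T *m e = (v 0 0)%:M.
  by apply/matrixP => i j; rewrite !ord1 -colE !mxE eqxx mulr1n.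
have ee : e^T *m e = 1%:M.
  by rewrite trmx_delta mul_delta_mx; apply/matrixP => i j; rewrite !ord1 !mxE.
have ww : w^T *m w = (2 * c)%:M.
  rewrite [w^T]linearB /= mulmxBl !mulmxBr v1 E ee.
  rewrite -[e^T *m v]trmxK trmx_mul trmxK E tr_scalar_mx.
  apply/matrixP => i j; rewrite !ord1 !mxE eqxx /= /c; ring.
have [c0|c0] := eqVneq c 0.
  exists 1%:M; first by rewrite /orthogonalmx trmx1 mulmx1.
  have : w = 0.
    have /matrixP/(_ 0 0) := ww; rewrite c0 mulr0 [RHS]mxE mul0rn => /eqP.
    rewrite mxE psumr_eq0 => [/allP w0|k _]; last by rewrite mxE -expr2 sqr_ge0.
    apply/colP => j; rewrite [RHS]mxE; apply/eqP; rewrite -sqrf_eq0.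
    by have := w0 j (mem_index_enum _); rewrite mxE -expr2.
  by move/eqP; rewrite mul1mx subr_eq0 => /eqP.
have we : w^T *m e = (- c)%:M.
  rewrite [w^T]linearB /= mulmxBl E ee.
  by apply/matrixP => i j; rewrite !ord1 !mxE eqxx /= /c; ring.
pose H := 1%:M - c^-1 *: (w *m w^T).
have HT : H^T = H by rewrite /H linearB /= trmx1 linearZ /= trmx_mul trmxK.
exists H.
  rewrite /orthogonalmx HT {2}/H mulmxBr mulmx1 -scalemxAr.
  have -> : H *m (w *m w^T) = - (w *m w^T).
    rewrite /H mulmxBl mul1mx -scalemxAl mulmxA -(mulmxA w) ww.
    rewrite mul_mx_scalar -scalemxAl scalerA mulrCA mulVf // mulr1.
    by rewrite scaler_nat mulr2n opprD addrA subrr sub0r.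
  by rewrite scalerN opprK /H subrK.
rewrite /H mulmxBl mul1mx -scalemxAl -mulmxA we mul_mx_scalar scalerA mulrN.
by rewrite mulVf // scaleN1r opprK /w addrC subrK.
Qed.

(** Deflation: a reflection sends a unit eigenvector to the first basis vector,
    which leaves a symmetric matrix of smaller size to diagonalize. *)
Lemma symmx_diagonalization (R : realType) n (A : 'M[R]_n) : A^T = A ->
  exists (U : 'M[R]_n) (d : 'rV[R]_n),
    orthogonalmx U /\ A = U *m diag_mx d *m U^T.
Proof.
elim: n A => [|n IHn] A sA.
  by exists 1%:M, 0; split; [rewrite /orthogonalmx trmx1 mulmx1|rewrite thinmx0 [RHS]thinmx0].
have [a [u [u0 uA]]] := symmx_eigenvector sA.
pose r := (u *m u^T) 0 0.
have rE : u *m u^T = r%:M by rewrite [LHS]mx11_scalar.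
have r0 : 0 < r.
  have r_ge0 : 0 <= r.
    by rewrite /r mxE sumr_ge0 // => j _; rewrite mxE -expr2 sqr_ge0.
  rewrite lt_def r_ge0 andbT; apply: contra u0 => /eqP r0.
  apply/eqP/rowP => j; rewrite mxE; apply/eqP; rewrite -sqrf_eq0.
  move/eqP: r0; rewrite /r mxE psumr_eq0 => [|k _]; last first.
    by rewrite mxE -expr2 sqr_ge0.
  by move/allP/(_ j (mem_index_enum _)); rewrite mxE -expr2.
pose v := (Num.sqrt r)^-1 *: u^T.
have v1 : v^T *m v = 1%:M.
  rewrite [v^T]linearZ /= trmxK /v -scalemxAl -scalemxAr rE scalerA -invfM -expr2.
  by rewrite sqr_sqrtr ?ltW // scale_scalar_mx mulVf // gt_eqF.
have Av : A *m v = a *: v.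
  by rewrite /v -scalemxAr -{1}sA -trmx_mul uA linearZ /= !scalerA mulrC.
have [H oH He] := householder v1.
have oH' : H^T *m H = 1%:M by exact: mulmx1C.
pose A' := H^T *m A *m H.
have sA' : A'^T = A' by rewrite /A' !trmx_mul trmxK sA mulmxA.
have A'e : A' *m delta_mx 0 0 = a *: delta_mx 0 0 :> 'cV[R]_n.+1.
  by rewrite /A' -mulmxA He -mulmxA Av -scalemxAr -He mulmxA oH' mul1mx.
have AE : A = H *m A' *m H^T.
  by rewrite /A' !mulmxA oH mul1mx -mulmxA oH mulmx1.
clearbody A'.
pose C := drsubmx (A' : 'M[R]_(1 + n)).
have A'E : A' = block_mx a%:M 0 0 C :> 'M[R]_(1 + n).
  have col0 i (j : 'I_1) : A' i (lshift n j) = a * (i == 0)%:R.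
    have /colP/(_ i) := A'e; rewrite -colE !mxE andbT => <-.
    by have -> : lshift n j = 0 :> 'I_n.+1 by apply: val_inj; rewrite /= ord1.
  rewrite -[LHS](@submxK _ 1 n 1 n); congr block_mx; apply/matrixP => i j.
  - by rewrite !mxE col0 !ord1 eqxx mulr1.
  - by rewrite !mxE -{1}sA' mxE col0 mulr0.
  - by rewrite !mxE col0 mulr0.
have sC : C^T = C.
  by apply/matrixP => i j; rewrite !mxE -{1}sA' mxE.
have [V [d [oV CE]]] := IHn C sC.
pose W := block_mx 1%:M 0 0 V : 'M[R]_(1 + n).
exists (H *m W), (row_mx a%:M d); split.
  rewrite /orthogonalmx trmx_mul mulmxA -(mulmxA H).
  have -> : W *m W^T = 1%:M.
    rewrite /W (@tr_block_mx _ 1 n 1 n) !trmx0 trmx1 (@mulmx_block _ 1 n 1 n 1 n).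
    by rewrite !mulmx0 !mul0mx mulmx1 !addr0 add0r oV -scalar_mx_block.
  by rewrite mulmx1.
rewrite AE trmx_mul !mulmxA; congr (_ *m _); rewrite -!mulmxA; congr (_ *m _).
rewrite (@diag_mx_row _ n 1) A'E CE /W (@tr_block_mx _ 1 n 1 n) !trmx0 trmx1.
rewrite !(@mulmx_block _ 1 n 1 n 1 n) !mulmx0 !mul0mx !mulmx1 !mul1mx !addr0 !add0r.
have -> : diag_mx (a%:M : 'rV[R]_1) = a%:M.
  by apply/matrixP => i j; rewrite !ord1 !mxE eqxx.
by rewrite mulmxA mulmx0.
Qed.

(** * Sorted spectra and interlacing *)

Definition spectral_dec (R : realType) n (A U : 'M[R]_n) (lam : nat -> R) :=
  [/\ orthogonalmx U,
      A = U *m diag_mx (\row_(l < n) lam l) *m U^T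
    & forall i j, (i <= j < n)%N -> lam i <= lam j].

Lemma spectral_mxE (R : realType) n (U : 'M[R]_n) (d : 'rV[R]_n) i j :
  (U *m diag_mx d *m U^T) i j = \sum_l U i l * d 0 l * U j l.
Proof. by rewrite mul_mx_diag mxE; apply: eq_bigr => l _; rewrite !mxE. Qed.

Lemma symmx_spectral_dec (R : realType) n (A : 'M[R]_n) : A^T = A ->
  exists U lam, spectral_dec A U lam.
Proof.
move=> /symmx_diagonalization[U [d [oU AE]]].
pose t := [tuple d 0 i | i < n].
have /tuple_permP[p sE] : perm_eq (sort <=%R t) t by rewrite perm_sort.
pose lam l := nth 0 (sort <=%R t) l.
have lamE (l : 'I_n) : lam l = d 0 (p l).
  by rewrite /lam sE nth_mktuple tnth_mktuple.
exists (col_perm p U), lam; split.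
- apply/matrixP => i k; have /matrixP/(_ i k) := oU; rewrite !mxE => <-.
  by rewrite [RHS](reindex_perm p); apply: eq_bigr => j _; rewrite !mxE.
- apply/matrixP => i k; rewrite AE !spectral_mxE (reindex_perm p).
  by apply: eq_bigr => j _; rewrite !mxE lamE.
- move=> i j /andP[ij jn]; rewrite /lam.
  have st : sorted <=%R (sort <=%R t) by apply: sort_sorted; exact: le_total.
  by apply: (sorted_leq_nth le_trans le_refl) => //;
    rewrite inE size_sort size_tuple // (leq_ltn_trans ij).
Qed.

Lemma spectral_form (R : realType) n (U : 'M[R]_n) (d x : 'rV[R]_n) :
  (x *m (U *m diag_mx d *m U^T) *m x^T) 0 0 =
    \sum_(l < n) d 0 l * (x *m U) 0 l ^+ 2.
Proof.
rewrite !mulmxA -(mulmxA _ U^T) -trmx_mul mul_mx_diag mxE.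
by apply: eq_bigr => l _; move: (x *m U) => y; rewrite !mxE; ring.
Qed.

Lemma orthogonalmx_norm (R : realType) n (U : 'M[R]_n) (x : 'rV[R]_n) :
  orthogonalmx U -> \sum_i x 0 i ^+ 2 = \sum_l (x *m U) 0 l ^+ 2.
Proof.
move=> oU; have normE (y : 'rV[R]_n) : \sum_i y 0 i ^+ 2 = (y *m y^T) 0 0.
  by rewrite mxE; apply: eq_bigr => i _; rewrite mxE expr2.
by rewrite !normE trmx_mul mulmxA -(mulmxA x) oU mulmx1.
Qed.

(** Half of Cauchy interlacing. By a dimension count some [x <> 0] vanishes
    at [i0], is orthogonal to the eigenvectors of the submatrix of index less
    than [s] and to those of [A] of index greater than [s.+1]; its Rayleigh
    quotient is then at least [mu s] and at most [lam s.+1]. *)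
Lemma cauchy_interlacing (R : realType) n (A U : 'M[R]_n.+1) lam i0
    (V : 'M[R]_n) mu : spectral_dec A U lam ->
  spectral_dec (row' i0 (col' i0 A)) V mu ->
  forall s, (s < n)%N -> mu s <= lam s.+1.
Proof.
move=> [oU AE lam_le] [oV BE mu_le] s sn.
(* The columns of [M] are the [s + 1 + (n - s - 1)] linear conditions on [x]. *)
pose M : 'M[R]_(n.+1, n) := \matrix_(i, l)
  if (l < s)%N then oapp (V ^~ l) 0 (unlift i0 i)
  else if l == s :> nat then (i == i0)%:R else U i (lift ord0 l).
have [x /sub_kermxP xM x0] : exists2 x : 'rV_n.+1, (x <= kermx M)%MS & x != 0.
  apply/rowV0Pn; rewrite kermx_eq0 /row_free; apply/eqP => rk.
  by have := rank_leq_col M; rewrite rk ltnn.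
pose y := col' i0 x.
have xi0 : x 0 i0 = 0.
  have /rowP/(_ (Ordinal sn)) := xM; rewrite !mxE (bigD1 i0) //= !mxE ltnn !eqxx.
  rewrite mulr1 big1 ?addr0 // => i /negPf ii0.
  by rewrite mxE ltnn /= eqxx ii0 mulr0.
have yV (l : 'I_n) : (l < s)%N -> (y *m V) 0 l = 0.
  move=> ls; have /rowP/(_ l) := xM; rewrite !mxE (bigD1_ord i0) //= xi0 mul0r add0r.
  by move=> h; rewrite -[RHS]h; apply: eq_bigr => i _; rewrite !mxE ls liftK.
have xU (l : 'I_n.+1) : (s.+1 < l)%N -> (x *m U) 0 l = 0.
  case: (unliftP ord0 l) => [k ->|->] //; rewrite lift0 ltnS => sk.
  have /rowP/(_ k) := xM; rewrite !mxE => h; rewrite -[RHS]h.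
  by apply: eq_bigr => i _; rewrite !mxE ltnNge (ltnW sk) /= gtn_eqF.
have yE : \sum_i y 0 i ^+ 2 = \sum_i x 0 i ^+ 2.
  rewrite [RHS](bigD1_ord i0) //= xi0 expr0n add0r.
  by apply: eq_bigr => i _; rewrite mxE.
have x_gt0 : 0 < \sum_i x 0 i ^+ 2.
  rewrite lt_def sumr_ge0 ?andbT => [|i _]; last exact: sqr_ge0.
  apply: contra x0; rewrite psumr_eq0 => [/allP x0|i _]; last exact: sqr_ge0.
  apply/eqP/rowP => i; rewrite mxE; apply/eqP; rewrite -sqrf_eq0.
  exact: x0 (mem_index_enum _).
have formE : (y *m row' i0 (col' i0 A) *m y^T) 0 0 = (x *m A *m x^T) 0 0.
  rewrite !mxE [RHS](bigD1_ord i0) //= [x^T i0 0]mxE xi0 mulr0 add0r.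
  apply: eq_bigr => i _; rewrite !mxE; congr (_ * _).
  rewrite [RHS](bigD1_ord i0) //= xi0 mul0r add0r.
  by apply: eq_bigr => j _; rewrite !mxE.
rewrite -(ler_pM2r x_gt0); apply: (@le_trans _ _ ((x *m A *m x^T) 0 0)).
  rewrite -formE BE spectral_form -yE (orthogonalmx_norm _ oV) mulr_sumr.
  apply: ler_sum => l _; have [ls|sl] := ltnP l s.
    by rewrite yV // expr0n !mulr0.
  by rewrite ler_wpM2r ?sqr_ge0 // mxE mu_le // sl /=.
rewrite AE spectral_form (orthogonalmx_norm _ oU) mulr_sumr.
apply: ler_sum => l _; have [sl|ls] := ltnP s.+1 l.
  by rewrite xU // expr0n !mulr0.
by rewrite ler_wpM2r ?sqr_ge0 // mxE lam_le // ls /= ltnS.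
Qed.

(** * The Micchelli-Willoughby theorem *)

Definition newton (R : comNzRingType) (lam : nat -> R) k x :=
  \prod_(m < k) (x - lam m).

Definition newton_mx (R : realType) n (U : 'M[R]_n) (lam : nat -> R) k :=
  U *m diag_mx (\row_(l < n) newton lam k (lam l)) *m U^T.

(** The products of the last factors of a characteristic polynomial: the
    coefficients of [newton_mx] in the adjugate of ['X - A]. *)
Definition tail_poly (R : comNzRingType) (lam : nat -> R) n k : {poly R} :=
  \prod_(k <= m < n) ('X - (lam m)%:P).

Lemma newton_eq0 (R : comNzRingType) (lam : nat -> R) k l :
  (l < k)%N -> newton lam k (lam l) = 0.
Proof. by move=> lk; rewrite /newton (bigD1 (Ordinal lk)) //= subrr mul0r. Qed.

Lemma newton_mx0 (R : realType) n (U : 'M[R]_n) lam :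
  orthogonalmx U -> newton_mx U lam 0 = 1%:M.
Proof.
move=> oU; rewrite -oU /newton_mx; congr (_ *m _).
rewrite -[RHS]mulmx1; congr (_ *m _).
by apply/matrixP => i j; rewrite !mxE /newton big_ord0.
Qed.

Lemma newton_mxS (R : realType) n (A U : 'M[R]_n) lam k :
  spectral_dec A U lam ->
  A *m newton_mx U lam k = lam k *: newton_mx U lam k + newton_mx U lam k.+1.
Proof.
move=> [oU -> _]; have oU' : U^T *m U = 1%:M by exact: mulmx1C.
rewrite /newton_mx !mulmxA -(mulmxA _ U^T) oU' mulmx1 -(mulmxA U) mulmx_diag.
apply/matrixP => i j; rewrite [RHS]mxE [X in _ = X + _]mxE !spectral_mxE.
rewrite mulr_sumr -big_split; apply: eq_bigr => l _ /=.
by rewrite !mxE /newton big_ord_recr /=; ring.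
Qed.

Lemma newton_mx_full (R : realType) n (U : 'M[R]_n) lam : newton_mx U lam n = 0.
Proof.
apply/matrixP => i j; rewrite spectral_mxE mxE big1 // => l _.
by rewrite mxE newton_eq0 // mulr0 mul0r.
Qed.

Lemma spectral_char_poly (R : realType) n (A U : 'M[R]_n) lam :
  spectral_dec A U lam -> char_poly A = tail_poly lam n 0.
Proof.
move=> [oU -> _]; set D := diag_mx _.
have -> : tail_poly lam n 0 = char_poly D.
  rewrite char_poly_trig ?diag_mx_is_trig // /tail_poly big_mkord.
  by apply: eq_bigr => i _; rewrite !mxE eqxx mulr1n.
have UU : map_mx polyC U *m map_mx polyC U^T = 1%:M.
  by rewrite -map_mxM oU map_mx1.
have -> : char_poly (U *m D *m U^T) =
    \det (map_mx polyC U *m char_poly_mx D *m map_mx polyC U^T).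
  rewrite /char_poly; congr (\det _); rewrite /char_poly_mx !map_mxM.
  by rewrite mulmxBr mulmxBl mul_mx_scalar -scalemxAl UU scalemx1.
by rewrite !det_mulmx mulrAC -det_mulmx UU det1 mul1r.
Qed.

Lemma adj_unique (R : idomainType) n (M X : 'M[R]_n) : \det M != 0 ->
  M *m X = (\det M)%:M -> X = \adj M.
Proof.
move=> M0 /(congr1 (mulmx (\adj M))).
rewrite mulmxA mul_adj_mx mul_scalar_mx mul_mx_scalar => E.
apply/matrixP => i j; have /matrixP/(_ i j) := E; rewrite !mxE.
exact: mulfI.
Qed.

(** Multiplying the sum by ['X - A = ('X - lam k) - (A - lam k)] telescopes to
    the characteristic polynomial. *)
Lemma adj_char_poly_mx (R : realType) n (A U : 'M[R]_n) lam :
  spectral_dec A U lam ->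
  \adj (char_poly_mx A) =
    \sum_(k < n) tail_poly lam n k.+1 *: map_mx polyC (newton_mx U lam k).
Proof.
move=> dA; have [oU _ _] := dA.
have det0 : \det (char_poly_mx A) != 0 by exact: monic_neq0 (char_poly_monic A).
apply/esym/adj_unique => //; rewrite mulmx_sumr.
pose T k := tail_poly lam n k *: map_mx polyC (newton_mx U lam k).
rewrite (eq_bigr (fun k : 'I_n => - (T k.+1 - T k))) => [|k _].
  rewrite sumrN -(big_mkord xpredT (fun k => T k.+1 - T k)) telescope_sumr //.
  rewrite /T newton_mx_full newton_mx0 // map_mx0 scaler0 sub0r opprK map_mx1.
  by rewrite scalemx1 -(spectral_char_poly dA).
have E : char_poly_mx A *m map_mx polyC (newton_mx U lam k) =
    ('X - (lam k)%:P) *: map_mx polyC (newton_mx U lam k)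
    - map_mx polyC (newton_mx U lam k.+1).
  rewrite /char_poly_mx mulmxBl mul_scalar_mx -map_mxM (newton_mxS _ dA).
  by rewrite map_mxD map_mxZ scalerBl opprD addrA.
rewrite -scalemxAr E scalerBr scalerA /T opprB; congr (_ *: _ - _).
by rewrite /tail_poly (big_ltn (ltn_ord k)) mulrC.
Qed.

(** With [B] the principal submatrix and [b] the deleted column, the rows of
    [M *m \adj M = (\det M)%:M] other than [i0] say that [B] maps the deleted
    column of the adjugate to [- \det B *: b]; applying [\adj B] and cancelling
    [\det B] gives the formula. *)
Lemma adj_border (R : idomainType) n (M : 'M[R]_n.+1) i0 i :
  \det (row' i0 (col' i0 M)) != 0 ->
  (\adj M) (lift i0 i) i0 =
    - \sum_j (\adj (row' i0 (col' i0 M))) i j * M (lift i0 j) i0.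
Proof.
set B := row' i0 (col' i0 M) => B0.
pose F : 'cV[R]_n := \col_j (\adj M) (lift i0 j) i0.
pose b : 'cV[R]_n := \col_j M (lift i0 j) i0.
have Fi0 : (\adj M) i0 i0 = \det B.
  by rewrite mxE /cofactor addnn -signr_odd odd_double mul1r.
have BF : B *m F = - (\det B *: b).
  apply/colP => j; have /matrixP/(_ (lift i0 j) i0) := mul_mx_adj M.
  rewrite mxE [RHS]mxE eq_sym (negPf (neq_lift _ _)) mulr0n (bigD1_ord i0) //= Fi0.
  rewrite addrC => /eqP; rewrite addr_eq0 => /eqP E; rewrite !mxE mulrC -E.
  by apply: eq_bigr => k _; rewrite !mxE.
have : \det B *: F = - (\det B *: (\adj B *m b)).
  by rewrite -mul_scalar_mx -mul_adj_mx -mulmxA BF mulmxN -scalemxAr.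
move/colP/(_ i); rewrite !mxE -mulrN => /(mulfI B0) ->.
by congr (- _); apply: eq_bigr => j _; rewrite !mxE.
Qed.

Lemma tail_polyS (R : comNzRingType) (lam : nat -> R) n k : (k < n)%N ->
  tail_poly lam n k = ('X - (lam k)%:P) * tail_poly lam n k.+1.
Proof. exact: big_ltn. Qed.

Lemma tail_poly_free (R : idomainType) (lam c : nat -> R) n :
  \sum_(0 <= k < n) c k *: tail_poly lam n k.+1 = 0 ->
  forall k, (k < n)%N -> c k = 0.
Proof.
(* All terms but the last vanish at the last node. *)
elim: n => // n IHn; rewrite big_nat_recr //=.
rewrite [tail_poly lam n.+1 n.+1]big_geq //.
rewrite (eq_big_nat _ _ (F2 := fun k => (c k *: tail_poly lam n k.+1) *
  ('X - (lam n)%:P))) => [|k /andP[_ kn]]; last first.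
  by rewrite /tail_poly big_nat_recr //= scalerAl.
rewrite -mulr_suml => E.
have cn : c n = 0 by have := congr1 (horner^~ (lam n)) E; rewrite !hornerE subrr mulr0 add0r.
move/eqP: E; rewrite cn scale0r addr0 mulf_eq0 polyXsubC_eq0 orbF => /eqP/IHn ck k.
by rewrite ltnS leq_eqVlt => /orP[/eqP->|/ck].
Qed.

(** The index [s] records which generators occur: it is what makes the
    coefficients in [tail_poly_interlaced] nonnegative. *)
Definition tail_cone (R : realType) (lam : nat -> R) n s (p : {poly R}) :=
  exists2 e : nat -> R, forall k, 0 <= e k &
    p = \sum_(s <= k < n) e k *: tail_poly lam n k.+1.

Lemma tail_cone_gen (R : realType) (lam : nat -> R) n s k a : 0 <= a ->
  (s <= k < n)%N -> tail_cone lam n s (a *: tail_poly lam n k.+1).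
Proof.
move=> a0 /andP[sk kn]; exists (fun m => if m == k then a else 0) => [m|].
  by case: ifP.
rewrite (@big_cat_nat _ _ _ k) //=; last exact: ltnW.
rewrite big_nat_cond big1 ?add0r => [|m /andP[/andP[_ mk] _]]; last first.
  by rewrite ltn_eqF // scale0r.
rewrite big_ltn // eqxx big_nat_cond big1 ?addr0 // => m /andP[/andP[km _] _].
by rewrite gtn_eqF // scale0r.
Qed.

Lemma tail_cone0 (R : realType) (lam : nat -> R) n s : tail_cone lam n s 0.
Proof. by exists (fun=> 0) => //; rewrite big1 // => k _; rewrite scale0r. Qed.

Lemma tail_coneD (R : realType) (lam : nat -> R) n s p q :
  tail_cone lam n s p -> tail_cone lam n s q -> tail_cone lam n s (p + q).
Proof.
move=> [e e0 ->] [e' e'0 ->]; exists (fun k => e k + e' k) => [k|].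
  exact: addr_ge0.
by rewrite -big_split; apply: eq_bigr => k _; rewrite scalerDl.
Qed.

Lemma tail_coneZ (R : realType) (lam : nat -> R) n s a p : 0 <= a ->
  tail_cone lam n s p -> tail_cone lam n s (a *: p).
Proof.
move=> a0 [e e0 ->]; exists (fun k => a * e k) => [k|]; first exact: mulr_ge0.
by rewrite scaler_sumr; apply: eq_bigr => k _; rewrite scalerA.
Qed.

Lemma tail_coneW (R : realType) (lam : nat -> R) n s t p : (s <= t)%N ->
  tail_cone lam n t p -> tail_cone lam n s p.
Proof.
move=> st [e e0 ->]; rewrite big_nat_cond.
by elim/big_ind: _ => [||k /andP[/andP[tk kn] _]]; [exact: tail_cone0|
  exact: tail_coneD|apply: tail_cone_gen => //; rewrite kn (leq_trans st)].
Qed.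

(** The interlacing [mu s <= lam s.+1] makes the coefficients nonnegative:
    passing from [s.+1] to [s] multiplies by
    ['X - mu s = ('X - lam k) + (lam k - mu s)], and only [k > s] occur. *)
Lemma tail_poly_interlaced (R : realType) (lam mu : nat -> R) n :
  (forall i j, (i <= j < n.+1)%N -> lam i <= lam j) ->
  (forall s, (s < n)%N -> mu s <= lam s.+1) ->
  forall s, (s <= n)%N -> tail_cone lam n.+1 s (tail_poly mu n s).
Proof.
move=> lam_le mu_le s; move: {2}(n - s)%N (erefl (n - s)%N) => t.
elim: t s => [|t IHt] s tE sn.
  have -> : s = n by lia.
  have -> : tail_poly mu n n = 1 *: tail_poly lam n.+1 n.+1.
    by rewrite scale1r /tail_poly !big_geq.
  by apply: tail_cone_gen => //; rewrite leqnn /=.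
have {}sn : (s < n)%N by lia.
have [e e0 eE] := IHt s.+1 ltac:(lia) sn.
rewrite tail_polyS // eE mulr_sumr big_nat_cond.
elim/big_ind: _ => [||k /andP[/andP[sk kn] _]].
- exact: tail_cone0.
- exact: tail_coneD.
have -> : ('X - (mu s)%:P) * (e k *: tail_poly lam n.+1 k.+1) =
    e k *: (1 *: tail_poly lam n.+1 k + (lam k - mu s) *: tail_poly lam n.+1 k.+1).
  rewrite scale1r -scalerAr; congr (_ *: _); rewrite [tail_poly _ _ k]tail_polyS //.
  rewrite -mul_polyC polyCB; ring.
apply: tail_coneZ => //; case: k sk kn => // k sk kn.
apply: tail_coneD; apply: tail_cone_gen => //; [lia| |lia].
by rewrite subr_ge0 (le_trans (mu_le _ sn)) // lam_le // sk.
Qed.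

(** Induction on the size. Diagonal entries are nonnegative because
    [newton lam k] is nonnegative on the spectrum. For the column [i0] outside
    the diagonal, both sides of [adj_border] for ['X - A] are expanded by
    [adj_char_poly_mx]; comparing coefficients on the basis [tail_poly lam]
    writes the entries of [newton_mx U lam k] as nonnegative combinations of
    those for the submatrix deleting [i0]. *)
Theorem micchelli_willoughby (R : realType) n (A U : 'M[R]_n) lam :
  spectral_dec A U lam -> (forall i j, i != j -> 0 <= A i j) ->
  forall k, (k < n)%N -> forall i j, 0 <= newton_mx U lam k i j.
Proof.
elim: n A U lam => // n IHn A U lam dA A_ge0 k kn i i0.
have [oU AE lam_le] := dA.
have [->|ii0] := eqVneq i i0.
  rewrite spectral_mxE sumr_ge0 // => l _; rewrite mulrAC -expr2.
  rewrite mulr_ge0 ?sqr_ge0 // mxE; have [lk|kl] := ltnP l k.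
    by rewrite newton_eq0.
  apply: prodr_ge0 => m _; rewrite subr_ge0 lam_le // ltn_ord andbT.
  by rewrite (leq_trans (ltnW (ltn_ord m))).
have sA : A^T = A.
  by rewrite AE !trmx_mul trmxK tr_diag_mx mulmxA.
case: (unliftP i0 i) ii0 => [{}i ->|-> /eqP//] _.
pose B := row' i0 (col' i0 A).
have sB : B^T = B by apply/matrixP => p q; rewrite !mxE -{1}sA mxE.
have [V [mu dB]] := symmx_spectral_dec sB.
have NB m : (m < n)%N -> forall p q, 0 <= newton_mx V mu m p q.
  apply: (IHn _ _ _ dB) => p q pq; rewrite !mxE A_ge0 //.
  by apply: contra pq => /eqP/lift_inj ->.
have BX : row' i0 (col' i0 (char_poly_mx A)) = char_poly_mx B.
  by rewrite row'_col'_char_poly_mx.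
have [e e0 eE] : tail_cone lam n.+1 0 ((\adj (char_poly_mx A)) (lift i0 i) i0).
  rewrite adj_border BX; last exact: monic_neq0 (char_poly_monic B).
  rewrite -sumrN; elim/big_ind: _ => [||j _].
  - exact: tail_cone0.
  - exact: tail_coneD.
  have -> : char_poly_mx A (lift i0 j) i0 = - (A (lift i0 j) i0)%:P.
    by rewrite !mxE eq_sym (negPf (neq_lift _ _)) mulr0n sub0r.
  rewrite mulrN opprK mulrC mul_polyC; apply: tail_coneZ.
    by rewrite A_ge0 // eq_sym neq_lift.
  rewrite (adj_char_poly_mx dB) summxE; elim/big_ind: _ => [||m _].
  - exact: tail_cone0.
  - exact: tail_coneD.
  rewrite !mxE [X in tail_cone _ _ _ X]mulrC mul_polyC; apply: tail_coneZ.
    by have := NB m (ltn_ord m) i j; rewrite mxE.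
  apply: (@tail_coneW _ _ _ _ m.+1) => //.
  apply: tail_poly_interlaced => // s sn.
  exact: cauchy_interlacing dA dB s sn.
have adjE : (\adj (char_poly_mx A)) (lift i0 i) i0 =
    \sum_(0 <= m < n.+1) newton_mx U lam m (lift i0 i) i0 *: tail_poly lam n.+1 m.+1.
  rewrite (adj_char_poly_mx dA) summxE big_mkord; apply: eq_bigr => m _.
  by rewrite mxE mulrC [X in X * _]mxE mul_polyC.
move/eqP: eE; rewrite adjE -subr_eq0 -sumrB => /eqP.
rewrite (eq_bigr (fun m => (newton_mx U lam m (lift i0 i) i0 - e m) *:
  tail_poly lam n.+1 m.+1)) => [|m _]; last by rewrite scalerBl.
move/(@tail_poly_free _ _ (fun m => newton_mx U lam m (lift i0 i) i0 - e m)).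
by move/(_ k kn)/eqP; rewrite subr_eq0 => /eqP ->.
Qed.

(** * Divided differences and Rolle's theorem *)

Definition deriv_chain (R : realType) (N : nat) (D : nat -> R -> R) :=
  forall k (x : R), (k < N)%N -> 0 < x -> is_derive x 1 (D k) (D k.+1 x).

Lemma is_derive_continuous (R : realType) (h : R -> R) (x dh : R) :
  is_derive x 1 h dh -> {for x, continuous h}.
Proof.
by move=> [dx _]; apply: differentiable_continuous; apply/derivable1_diffP.
Qed.

Lemma nneg_within_continuous (R : realType) (h : R -> R) (a b : R) :
  h t @[t --> 0^'+] --> h 0 -> (forall x, 0 < x -> {for x, continuous h}) ->
  0 <= a -> a < b -> {within `[a, b], continuous h}.
Proof.
move=> h0 hc a0 ab; apply/continuous_within_itvP => //; split.
- move=> x; rewrite in_itv /= => /andP[ax _]; exact: hc (le_lt_trans a0 ax).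
- move: a0; rewrite le_eqVlt => /orP[/eqP <- //|a0].
  exact: cvg_at_right_filter (hc _ a0).
- exact: cvg_at_left_filter (hc _ (le_lt_trans a0 ab)).
Qed.

(** Rolle iterated: [N.+2] zeros of a function leave [N.+1] zeros of its
    derivative, all positive. So only the function itself is asked to be
    continuous at the first node, which may be 0. *)
Lemma rolle_iter (R : realType) N (D : nat -> R -> R) (x : nat -> R) :
  deriv_chain N.+1 D -> {within `[x 0%N, x N.+1], continuous (D 0%N)} ->
  0 <= x 0%N -> (forall i, (i <= N)%N -> x i < x i.+1) ->
  (forall i, (i <= N.+1)%N -> D 0%N (x i) = 0) ->
  exists2 c, x 0%N < c < x N.+1 & D N.+1 c = 0.
Proof.
elim: N D x => [|N IHN] D x dD D0 x0 x_lt Dx; last first.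
  have x_le i j : (i <= j <= N.+2)%N -> x i <= x j.
    elim: j => [|j IHj]; first by rewrite leqn0 => /andP[/eqP ->].
    rewrite leq_eqVlt => /andP[/orP[/eqP -> //|ij] jN].
    apply: (le_trans (IHj _)); first by lia.
    by apply/ltW/x_lt; lia.
  have x_ge0 i : (i <= N.+2)%N -> 0 <= x i.
    by move=> iN; apply: le_trans (x_le 0%N i _).
  have rolle i : exists c, (i <= N.+1)%N -> x i < c < x i.+1 /\ D 1%N c = 0.
    have [iN|] := leqP i N.+1; last by exists 0.
    have [||||c] := @Rolle R (D 0%N) (x i) (x i.+1).
    - exact: x_lt.
    - move=> t; rewrite in_itv /= => /andP[xt _].
      by have [] := dD 0%N t isT (le_lt_trans (x_ge0 _ (leqW iN)) xt).
    - apply: continuous_subspaceW D0; apply: subset_itvScc; rewrite bnd_simp.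
        by apply: x_le; lia.
      by apply: x_le; lia.
    - by rewrite !Dx // ltnW.
    rewrite in_itv /= => cx [_ dc]; exists c => _; split => //.
    have c0 : 0 < c.
      by case/andP: cx => xc _; exact: le_lt_trans (x_ge0 _ (leqW iN)) xc.
    by rewrite -dc; case: (dD 0%N c isT c0).
  have [y yP] := choice rolle.
  have y0 : 0 < y 0%N.
    by have [/andP[xy _] _] := yP 0%N isT; exact: le_lt_trans xy.
  have [|||||c /andP[yc cy] Dc] := IHN (fun k => D k.+1) y.
  - by move=> k t kN t0; exact: dD.
  - apply: derivable_within_continuous => t; rewrite in_itv /= => /andP[yt _].
    by have [] := dD 1%N t isT (lt_le_trans y0 yt).
  - exact: ltW.
  - move=> i iN; have [/andP[_ yx] _] := yP i (leqW iN).
    by have [/andP[xy _] _] := yP i.+1 iN; exact: lt_trans xy.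
  - by move=> i iN; have [] := yP i iN.
  exists c => //; have [/andP[xy _] _] := yP 0%N isT.
  have [/andP[_ yx] _] := yP N.+1 (leqnn _).
  by rewrite (lt_trans xy yc) (lt_trans cy yx).
have [||||c] := @Rolle R (D 0%N) (x 0%N) (x 1%N).
- exact: x_lt.
- move=> t; rewrite in_itv /= => /andP[xt _].
  by have [] := dD 0%N t isT (le_lt_trans x0 xt).
- exact: D0.
- by rewrite !Dx.
rewrite in_itv /= => cx [_ dc]; exists c => //.
have c0 : 0 < c by case/andP: cx => xc _; exact: le_lt_trans xc.
by rewrite -dc; case: (dD 0%N c isT c0).
Qed.

Lemma newton_neq0 (R : realType) (x : nat -> R) k :
  (forall i, (i < k)%N -> x i < x k) -> newton x k (x k) != 0.
Proof.
by move=> xk; apply/prodf_neq0 => m _; rewrite subr_eq0 gt_eqF ?xk.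
Qed.

(** The coefficients are the divided differences of [h]; each is determined by
    the value at its own node, the later Newton products being zero there. *)
Lemma newton_interpolation (R : realType) (h : R -> R) (x : nat -> R) N :
  (forall i j, (i < j < N)%N -> x i < x j) ->
  exists a : nat -> R, forall l, (l < N)%N ->
    h (x l) = \sum_(k < N) a k * newton x k (x l).
Proof.
elim: N => [|N IHN] x_lt; first by exists (fun=> 0).
have [i j ij|a aE] := IHN; first by apply: x_lt; lia.
pose aN := (h (x N) - \sum_(k < N) a k * newton x k (x N)) / newton x N (x N).
exists (fun k => if k == N then aN else a k) => l.
rewrite big_ord_recr /= eqxx ltnS leq_eqVlt => /orP[/eqP ->|lN].
  rewrite divfK; last by apply: newton_neq0 => i iN; apply: x_lt; lia.
  rewrite (eq_bigr (fun k : 'I_N => a k * newton x k (x N))) => [|k _]; first ring.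
  by rewrite ltn_eqF.
rewrite newton_eq0 // mulr0 addr0 aE //; apply: eq_bigr => k _.
by rewrite ltn_eqF.
Qed.

Lemma newton_horner (R : comNzRingType) (x : nat -> R) k t :
  (\prod_(m < k) ('X - (x m)%:P)).[t] = newton x k t.
Proof. by rewrite horner_prod; apply: eq_bigr => m _; rewrite !hornerE. Qed.

(** The mean value theorem for divided differences: [rolle_iter] applied to
    the difference between the function and its interpolation polynomial. *)
Lemma newton_coef_mvt (R : realType) N (D : nat -> R -> R) (x a : nat -> R) :
  deriv_chain N.+1 D -> {within `[x 0%N, x N.+1], continuous (D 0%N)} ->
  0 <= x 0%N -> (forall i, (i <= N)%N -> x i < x i.+1) ->
  (forall l, (l <= N.+1)%N ->
    D 0%N (x l) = \sum_(k < N.+2) a k * newton x k (x l)) ->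
  exists2 c, x 0%N < c < x N.+1 & D N.+1 c = a N.+1 * N.+1`!%:R.
Proof.
move=> dD D0 x0 x_lt Dx.
pose P := \sum_(k < N.+2) a k *: \prod_(m < k) ('X - (x m)%:P).
have PE t : P.[t] = \sum_(k < N.+2) a k * newton x k t.
  by rewrite horner_sum; apply: eq_bigr => k _; rewrite hornerZ newton_horner.
have size_factor k : size (\prod_(m < k) ('X - (x m)%:P)) = k.+1.
  by rewrite size_prod_XsubC -[index_enum _]enumT size_enum_ord.
have dP : P^`(N.+1) = (a N.+1 * N.+1`!%:R)%:P.
  apply/polyP => i; rewrite coef_derivn coefC.
  have [->|i0] := eqVneq i 0%N.
    rewrite addn0 ffactnn mulr_natr; congr (_ *+ _).
    rewrite coef_sum big_ord_recr /= big1 ?add0r => [|k _]; last first.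
      by rewrite coefZ nth_default ?mulr0 // size_factor.
    rewrite coefZ.
    have /monicP := monic_prod_XsubC (index_enum 'I_N.+1) xpredT (fun m => x m).
    by rewrite lead_coefE size_factor /= => ->; rewrite mulr1.
  rewrite coef_sum big1 ?mul0rn // => k _.
  by rewrite coefZ nth_default ?mulr0 // size_factor; move: (ltn_ord k) i0; lia.
have [|||||c xc Ec] := @rolle_iter R N (fun k t => D k t - P^`(k).[t]) x.
- move=> k t kN t0; rewrite derivnS; apply: is_deriveB; first exact: dD.
- have cP : {within `[x 0%N, x N.+1], continuous (horner P^`(0))}.
    by apply: continuous_subspaceT; exact: continuous_horner.
  by move=> t; exact: cvgB (D0 t) (cP t).
- exact: x0.
- exact: x_lt.
- by move=> i iN /=; rewrite PE Dx // subrr.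
exists c => //; move/eqP: Ec; rewrite subr_eq0 dP hornerC => /eqP //.
Qed.

(** * Functionals nonnegative on Newton products *)

Lemma continuous_bounded (R : realType) (h : R -> R) (a b : R) : a <= b ->
  (forall x, a <= x -> {for x, continuous h}) ->
  exists M, forall x, a <= x <= b -> h x <= M.
Proof.
move=> ab hc; have [|c _ cM] := @EVT_max R h a b ab.
  apply: continuous_in_subspaceT => x; rewrite inE /= in_itv /= => /andP[ax _].
  exact: hc.
by exists (h c) => x xab; apply: cM; rewrite in_itv.
Qed.

Lemma newton_coef_values (R : realType) N (D : nat -> R -> R) (x : nat -> R) :
  deriv_chain N.+1 D -> 0 < x 0%N ->
  (forall i j, (i < j < N.+2)%N -> x i < x j) ->
  exists2 a : nat -> R,
    forall l, (l < N.+2)%N -> D 0%N (x l) = \sum_(k < N.+2) a k * newton x k (x l) &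
    forall k, (k < N.+2)%N ->
      exists2 c, x 0%N <= c <= x N.+1 & D k c = a k * k`!%:R.
Proof.
move=> dD x0 x_lt; have [a aE] := newton_interpolation (D 0%N) x_lt.
have x_le i j : (i <= j < N.+2)%N -> x i <= x j.
  rewrite leq_eqVlt => /andP[/orP[/eqP -> //|ij] jN].
  by apply/ltW/x_lt; rewrite ij.
exists a => // -[|k] kN.
  exists (x 0%N); first by rewrite lexx x_le // leqnn.
  rewrite aE // big_ord_recl /newton big_ord0 ?fact0 !mulr1 big1 ?addr0 // => i _.
  by rewrite big_ord_recl subrr mul0r mulr0.
have [|||||c /andP[xc cx] cE] := @newton_coef_mvt R k D x a.
- by move=> i t ik; apply: dD; lia.
- apply: derivable_within_continuous => t; rewrite in_itv /= => /andP[xt _].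
  by have [] := dD 0%N t isT (lt_le_trans x0 xt).
- exact: ltW.
- by move=> i ik; apply: x_lt; lia.
- move=> l lk; rewrite aE; last by lia.
  rewrite -!(big_mkord xpredT (fun i => a i * newton x i (x l))).
  rewrite (@big_cat_nat _ _ _ k.+2) //= [X in _ + X]big_nat_cond.
  rewrite [X in _ + X]big1 ?addr0 // => i /andP[/andP[ki _] _].
  by rewrite newton_eq0 ?mulr0 //; lia.
exists c => //; rewrite (ltW xc) (le_trans (ltW cx)) // x_le //; lia.
Qed.

(** If the functional [h |-> \sum_l c l * h (lam l)] is nonnegative on the
    Newton products, it is so on functions with nonnegative derivatives, by
    Newton's formula. Nodes may coincide, or vanish where derivatives blow up:
    they are first moved to the right by [delta], then separated by
    [eps * l]. The coefficients stay bounded as [eps] tends to 0, while the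
    values of the functional on the Newton products converge. *)
Lemma newton_functional_ge0 (R : realType) N (lam c : nat -> R) D :
  (forall i j, (i <= j < N.+2)%N -> lam i <= lam j) ->
  (forall i, (i < N.+2)%N -> 0 <= lam i) ->
  (forall k, (k < N.+2)%N -> 0 <= \sum_(l < N.+2) c l * newton lam k (lam l)) ->
  deriv_chain N.+1 D ->
  (forall k x, (k < N.+2)%N -> 0 < x -> 0 <= D k x) ->
  (forall x, 0 < x -> {for x, continuous (D N.+1)}) ->
  D 0%N t @[t --> 0^'+] --> D 0%N 0 ->
  0 <= \sum_(l < N.+2) c l * D 0%N (lam l).
Proof.
move=> lam_le lam_ge0 L_ge0 dD D_ge0 Dtop D0.
have Dc k x : (k < N.+2)%N -> 0 < x -> {for x, continuous (D k)}.
  rewrite ltnS leq_eqVlt => /orP[/eqP ->|kN] x0; first exact: Dtop.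
  exact: is_derive_continuous (dD k x kN x0).
have sum_cvg (F : set_system R) (FF : Filter F) m (u : 'I_m -> R -> R)
    (v : 'I_m -> R) : (forall i, u i t @[t --> F] --> v i) ->
    \sum_(i < m) u i t @[t --> F] --> \sum_(i < m) v i.
  by move=> uv; apply: cvg_big => [|i _]; [exact: add_continuous|exact: uv].
have shifted (delta : R) : 0 < delta ->
    0 <= \sum_(l < N.+2) c l * D 0%N (lam l + delta).
  move=> delta0; pose x eps l : R := lam l + delta + eps * l%:R.
  pose b := lam N.+1 + delta + N.+1%:R.
  have lamb : delta <= b.
    by rewrite /b -addrA addrCA lerDl addr_ge0 ?ler0n ?lam_ge0.
  have bnd (k : 'I_N.+2) : exists M, forall t, delta <= t <= b -> D k t <= M.
    apply: continuous_bounded lamb _ => t dt; apply: Dc => //.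
    exact: lt_le_trans dt.
  have [B BP] := choice bnd; pose M := \sum_(k < N.+2) B k.
  have B_ge0 k : 0 <= B k.
    by apply: le_trans (BP k delta _); rewrite ?lexx ?lamb // D_ge0.
  have DM k t : (k < N.+2)%N -> delta <= t <= b -> D k t <= M.
    move=> kN tb; apply: (le_trans (BP (Ordinal kN) t tb)).
    by rewrite /M (bigD1 (Ordinal kN)) //= lerDl sumr_ge0.
  have M0 : 0 <= M by rewrite sumr_ge0.
  pose G k : {poly R} := \sum_(l < N.+2) c l *:
    \prod_(m < k) ((lam l - lam m)%:P + (l%:R - m%:R) *: 'X).
  have GE k eps : (G k).[eps] = \sum_(l < N.+2) c l * newton (x eps) k (x eps l).
    rewrite horner_sum; apply: eq_bigr => l _; rewrite hornerZ horner_prod.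
    congr (_ * _); apply: eq_bigr => m _; rewrite !hornerE /x; ring.
  have G0 k : (k < N.+2)%N -> 0 <= (G k).[0].
    move=> kN; rewrite GE; apply: le_trans (L_ge0 k kN) _.
    rewrite le_eqVlt; apply/orP; left; apply/eqP; apply: eq_bigr => l _.
    by congr (_ * _); apply: eq_bigr => m _; rewrite /x; ring.
  pose Phi eps := \sum_(l < N.+2) c l * D 0%N (x eps l)
    + M * \sum_(k < N.+2) `|(G k).[eps] - (G k).[0]|.
  have Phi_cvg : Phi eps @[eps --> 0^'+] --> Phi 0.
    apply: cvg_at_right_filter; apply: cvgD.
      apply: sum_cvg => l; apply: cvgMr.
      apply: (@cvg_comp _ _ _ (fun eps => x eps l) (D 0%N) _ (nbhs (x 0 l))); last first.
        apply: Dc => //; rewrite /x mul0r addr0; apply: ltr_wpDl => //.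
        exact: lam_ge0.
      by apply: cvgD; [exact: cvg_cst|apply: cvgMl; exact: cvg_id].
    apply: cvgMr; apply: sum_cvg => k; apply: cvg_norm; apply: cvgB.
      exact: continuous_horner.
    exact: cvg_cst.
  suff Phi_ge0 : \forall eps \near 0^'+, 0 <= Phi eps.
    have : 0 <= Phi 0 by exact: cvgr_to_ge Phi_cvg Phi_ge0.
    rewrite /Phi [X in _ + _ * X]big1 => [|k _].
      rewrite mulr0 addr0; under eq_bigr do rewrite /x mul0r addr0.
      exact.
    by rewrite subrr normr0.
  near=> eps.
  have eps0 : 0 < eps by near: eps; exact: nbhs_right_gt.
  have eps1 : eps < 1 by near: eps; apply: nbhs_right_lt; exact: ltr01.
  have x_lt i j : (i < j < N.+2)%N -> x eps i < x eps j.
    move=> /andP[ij jN]; rewrite /x; apply: ler_ltD.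
      by rewrite lerD2r lam_le // (ltnW ij).
    by rewrite ltr_pM2l // ltr_nat.
  have x0 : delta <= x eps 0%N by rewrite /x mulr0 addr0 lerDr lam_ge0.
  have xN : x eps N.+1 <= b.
    by rewrite /x /b lerD2l ler_piMl ?ler0n // ltW.
  have [a aE aD] := newton_coef_values dD (lt_le_trans delta0 x0) x_lt.
  have a_ge0 k : (k < N.+2)%N -> 0 <= a k <= M.
    move=> kN; have [t /andP[xt tx] tE] := aD k kN.
    have f1 : 1 <= k`!%:R :> R by rewrite ler1n fact_gt0.
    have t0 : 0 < t by apply: lt_le_trans (le_trans x0 xt).
    have Dt := D_ge0 k t kN t0.
    have a0 : 0 <= a k.
      by move: Dt; rewrite tE pmulr_lge0 // (lt_le_trans ltr01).
    rewrite a0 /=; apply: le_trans (DM k t kN _); last first.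
      by rewrite (le_trans x0 xt) (le_trans tx xN).
    by rewrite tE ler_peMr.
  have -> : Phi eps = \sum_(k < N.+2)
      (a k * (G k).[eps] + M * `|(G k).[eps] - (G k).[0]|).
    rewrite big_split /= -mulr_sumr; congr (_ + _).
    rewrite (eq_bigr (fun l : 'I_N.+2 => \sum_(k < N.+2)
      c l * (a k * newton (x eps) k (x eps l)))) => [|l _]; last first.
      by rewrite aE // mulr_sumr.
    rewrite exchange_big; apply: eq_bigr => k _; rewrite GE mulr_sumr.
    by apply: eq_bigr => l _; rewrite mulrCA.
  apply: sumr_ge0 => k _; have /andP[a0 aM] := a_ge0 k (ltn_ord k).
  have := G0 k (ltn_ord k); set g := (G k).[eps]; set g0 := (G k).[0] => g0_ge0.
  have h1 : - `|g - g0| <= g - g0 by rewrite lerNl -normrN ler_norm.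
  have h2 := normr_ge0 (g - g0).
  nra.
have cvg0 : \sum_(l < N.+2) c l * D 0%N (lam l + t) @[t --> 0^'+] -->
    \sum_(l < N.+2) c l * D 0%N (lam l).
  apply: sum_cvg => l; apply: cvgMr.
  have := lam_ge0 l (ltn_ord l); rewrite le_eqVlt => /orP[/eqP <-|l0].
    by under eq_fun do rewrite add0r.
  apply: cvg_at_right_filter.
  apply: (@cvg_comp _ _ _ (fun t => lam l + t) (D 0%N) _ (nbhs (lam l))); last first.
    exact: Dc.
  have : lam l + t @[t --> 0] --> lam l + 0.
    by apply: cvgD; [exact: cvg_cst|exact: cvg_id].
  by rewrite addr0.
apply: cvgr_to_ge cvg0 _.
near=> t; apply: shifted; near: t; exact: nbhs_right_gt.
Unshelve. all: by end_near.
Qed.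

(** * Functions with nonnegative derivatives *)

(** Nonnegative derivatives up to the order [N], the last one continuous, on the
    positive half-line. The recursion makes closure under products an induction
    that uses only [(g h)' = g h' + g' h]. *)
Fixpoint nonneg_derivs (R : realType) (N : nat) (h : R -> R) : Prop :=
  (forall x : R, 0 < x -> 0 <= h x) /\
  if N is N'.+1 then
    exists2 dh : R -> R, (forall x : R, 0 < x -> is_derive x 1 h (dh x)) &
      nonneg_derivs N' dh
  else forall x : R, 0 < x -> {for x, continuous h}.

Lemma nonneg_derivsW (R : realType) N (h : R -> R) :
  nonneg_derivs N.+1 h -> nonneg_derivs N h.
Proof.
elim: N h => [|N IHN] h [h0 [dh hdh]] ndh; split=> //.
  by move=> x x0; exact: is_derive_continuous (hdh x x0).
by exists dh => //; exact: IHN.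
Qed.

Lemma nonneg_derivs_congr (R : realType) N (h1 h2 : R -> R) :
  (forall x : R, 0 < x -> h1 x = h2 x) -> nonneg_derivs N h1 -> nonneg_derivs N h2.
Proof.
move=> h12; have near12 (x : R) : 0 < x -> \forall y \near x, h1 y = h2 y.
  by move=> x0; near=> y; apply: h12; near: y; exact: lt_nbhsr.
case: N => [|N] [h_ge0 hN]; split=> [x x0|].
- by rewrite -h12 ?h_ge0.
- move=> x x0; have hx : h1 t @[t --> x] --> h1 x := hN x x0.
  rewrite h12 // in hx; apply: cvg_trans hx; apply: near_eq_cvg.
  exact: near12.
- by rewrite -h12 ?h_ge0.
- case: hN => dh hdh ndh; exists dh => // x x0.
  exact: near_eq_is_derive (near12 x x0) (hdh x x0).
Unshelve. all: by end_near.
Qed.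

Lemma nonneg_derivs0 (R : realType) N : nonneg_derivs N (fun=> 0 : R).
Proof.
elim: N => [|N IHN]; split=> //.
  by move=> x _; exact: cvg_cst.
by exists (fun=> 0) => // x _; exact: is_derive_cst.
Qed.

Lemma nonneg_derivsD (R : realType) N (g h : R -> R) :
  nonneg_derivs N g -> nonneg_derivs N h -> nonneg_derivs N (g \+ h).
Proof.
elim: N g h => [|N IHN] g h [g0 gN] [h0 hN]; split=> [x x0|].
- by rewrite addr_ge0 ?g0 ?h0.
- by move=> x x0; apply: cvgD; [exact: gN|exact: hN].
- by rewrite addr_ge0 ?g0 ?h0.
- case: gN hN => dg gdg ndg [dh hdh ndh].
  exists (dg \+ dh); last exact: IHN.
  by move=> x x0; apply: is_deriveD; [exact: gdg|exact: hdh].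
Qed.

Lemma nonneg_derivsM (R : realType) N (g h : R -> R) :
  nonneg_derivs N g -> nonneg_derivs N h -> nonneg_derivs N (g \* h).
Proof.
elim: N g h => [|N IHN] g h ng nh; have [g0 gN] := ng; have [h0 hN] := nh.
  split=> [x x0|x x0]; first by rewrite mulr_ge0 ?g0 ?h0.
  by apply: cvgM; [exact: gN|exact: hN].
split=> [x x0|]; first by rewrite mulr_ge0 ?g0 ?h0.
case: gN hN => dg gdg ndg [dh hdh ndh].
exists (g \* dh \+ dg \* h).
  move=> x x0; apply: is_derive_eq.
    by apply: is_deriveM; [exact: gdg|exact: hdh].
  by rewrite /GRing.scale /= [h x * _]mulrC.
by apply: nonneg_derivsD; apply: IHN => //; exact: nonneg_derivsW.
Qed.

Lemma nonneg_derivsZ (R : realType) N a (h : R -> R) : 0 <= a ->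
  nonneg_derivs N h -> nonneg_derivs N (fun x => a * h x).
Proof.
move=> a0; elim: N h => [|N IHN] h [h0 hN]; split=> [x x0|].
- by rewrite mulr_ge0 ?h0.
- by move=> x x0; apply: cvgMr; exact: hN.
- by rewrite mulr_ge0 ?h0.
- case: hN => dh hdh ndh; exists (fun x => a * dh x); last exact: IHN.
  move=> x x0; exact: is_deriveZ (hdh x x0).
Qed.

(** In the derivative [a * (a - 1) * ... * (a - k + 1) * x `^ (a - k)] of order
    [k <= N] no factor is negative if [N - 1 <= a], and a zero factor precedes
    the negative ones if [a] is a natural number. *)
Lemma nonneg_derivs_powR (R : realType) N (a : R) :
  (exists k : nat, a = k%:R) \/ N%:R <= a + 1 ->
  nonneg_derivs N (fun x => x `^ a).
Proof.
elim: N a => [|N IHN] a Na; split=> [x x0|]; rewrite ?powR_ge0 //.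
  by move=> x x0; exact: is_derive_continuous (is_derive1_powR a x0).
have [a0|a0] := eqVneq a 0.
  exists (fun=> 0); last exact: nonneg_derivs0.
  by move=> x x0; apply: is_derive_eq (is_derive1_powR a x0) _; rewrite a0 mul0r.
exists (fun x => a * x `^ (a - 1)) => [x x0|]; first exact: is_derive1_powR.
apply: nonneg_derivsZ.
  by case: Na => [[k ->]//|]; rewrite -natr1 lerD2r; exact: le_trans.
apply: IHN; case: Na => [[[|k] ak]|Na].
- by rewrite ak eqxx in a0.
- by left; exists k; rewrite ak -natr1 addrK.
- by right; move: Na; rewrite -natr1; lra.
Qed.

Lemma nonneg_derivs_chain (R : realType) N (h : R -> R) : nonneg_derivs N h ->
  exists D : nat -> R -> R, [/\ D 0%N = h, deriv_chain N D,
    forall k (x : R), (k <= N)%N -> 0 < x -> 0 <= D k x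
    & forall x : R, 0 < x -> {for x, continuous (D N)}].
Proof.
elim: N h => [|N IHN] h [h0 hN].
  by exists (fun=> h); split => // k x _; exact: h0.
case: hN => dh hdh /IHN[D [D0 dD D_ge0 Dc]].
exists (fun k => if k is k'.+1 then D k' else h); split => //.
- by move=> [|k] x kN x0; rewrite ?D0; [exact: hdh|exact: dD].
- by move=> [|k] x kN x0; [exact: h0|exact: D_ge0].
Qed.

Lemma is_derive_within (R : realType) (g : R -> R) (x l : R) : 0 < x ->
  (g y - g x) / (y - x) @[y --> within `[0, +oo[ x^'] --> l ->
  is_derive x 1 g l.
Proof.
move=> x0 gl.
have cl : (fun h : R => h^-1 *: ((g \o shift x) (h *: (1 : R)) - g x)) @ 0^' --> l.
  apply/cvgrPdist_lt => e e0; have /cvgrPdist_lt/(_ e e0) := gl.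
  rewrite !near_withinE => /nbhs_ballP[d /= d0 dP].
  apply/nbhs_ballP; exists (Num.min d x) => /=; first by rewrite lt_min d0.
  move=> h; rewrite /ball /= sub0r normrN lt_min => /andP[hd hx] h0.
  have := dP (h + x); rewrite /ball /= opprD addrCA subrr addr0 normrN hd.
  move=> /(_ isT); rewrite /= -[X in _ != X]add0r.
  have hx0 : h + x != 0 + x by rewrite (inj_eq (addIr x)).
  have hx1 : 0 <= h + x by move: hx; rewrite ltr_norml => /andP[]; lra.
  move=> /(_ hx0); rewrite in_itv /= andbT => /(_ hx1).
  by rewrite addrK [_ / h]mulrC [h *: 1]mulr1.
by apply: DeriveDef; [apply/cvg_ex; exists l|exact: cvg_lim cl].
Qed.

Lemma class_C_nonneg_derivs (R : realType) N (f : R -> R) :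
  class_C_nneg N f -> (forall x, 0 <= x -> 0 <= f x) ->
  (forall i, (0 < i <= N)%N -> forall x : R, 0 < x -> 0 <= derive1n i f x) ->
  nonneg_derivs N f.
Proof.
move=> [g [g0 dg gc]] f_ge0 df_ge0.
have dgx i (x : R) : (i < N)%N -> 0 < x -> is_derive x 1 (g i) (g i.+1 x).
  by move=> iN x0; apply: is_derive_within x0 (dg i x iN (ltW x0)).
have gE i : (i <= N)%N -> forall x : R, 0 < x -> derive1n i f x = g i x.
  elim: i => [|i IHi] iN x x0; first by rewrite /= g0 ?ltW.
  rewrite derive1nS derive1E; case: (dgx i x iN x0) => _ <-.
  apply: near_eq_derive; near=> y; apply: IHi; first exact: ltnW.
  by near: y; exact: lt_nbhsr.
have g_ge0 i (x : R) : (i <= N)%N -> 0 < x -> 0 <= g i x.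
  move=> iN x0; case: i iN => [|i] iN; first by rewrite g0 ?f_ge0 ?ltW.
  by rewrite -gE // df_ge0.
suff gN k i : (k + i = N)%N -> nonneg_derivs k (g i).
  apply: (@nonneg_derivs_congr _ _ (g 0%N)); last by apply: gN; rewrite addn0.
  by move=> x x0; rewrite g0 ?ltW.
elim: k i => [|k IHk] i kiN.
  split=> [x x0|x x0]; first by apply: g_ge0 => //; rewrite -kiN.
  have /gc/continuous_within_itvcyP[+ _] : (i <= N)%N by rewrite -kiN.
  by apply; rewrite in_itv /= andbT.
split=> [x x0|]; first by apply: g_ge0 => //; rewrite -kiN leq_addl.
exists (g i.+1); last by apply: IHk; rewrite addnS -kiN addSn.
by move=> x x0; apply: dgx => //; rewrite -kiN addSn ltnS leq_addl.
Unshelve. all: by end_near.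
Qed.

Lemma class_C_right_continuous (R : realType) N (f : R -> R) :
  class_C_nneg N f -> f t @[t --> 0^'+] --> f 0.
Proof.
move=> [g [g0 _ /(_ 0%N isT)/continuous_within_itvcyP[_]]].
rewrite g0 //; apply: cvg_trans; apply: near_eq_cvg.
near=> t; rewrite g0 //; apply/ltW; near: t; exact: nbhs_right_gt.
Unshelve. all: by end_near.
Qed.

Lemma pow_mul_right_continuous (R : realType) (a : R) (f : R -> R) : 0 <= a ->
  f t @[t --> 0^'+] --> f 0 ->
  pow_mul a f t @[t --> 0^'+] --> pow_mul a f 0.
Proof.
move=> a0 fc; apply: cvgM => //.
have [->|a_neq0] := eqVneq a 0.
  by rewrite powRr0; under eq_fun do rewrite powRr0; exact: cvg_cst.
by rewrite powR0 //; apply: powR_cvg0; rewrite lt_def a_neq0.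
Qed.

Lemma DN_spectral_ge0 (R : realType) n (U : 'M[R]_n) (d : 'rV[R]_n) :
  orthogonalmx U -> psdmx (U *m diag_mx d *m U^T) -> forall l, 0 <= d 0 l.
Proof.
move=> oU [_ A_ge0] l; have oU' : U^T *m U = 1%:M by exact: mulmx1C.
have := A_ge0 (row l U^T)^T; rewrite trmxK spectral_form (bigD1 l) //=.
rewrite -row_mul oU' !mxE eqxx expr1n mulr1 big1 ?addr0 // => m ml.
by rewrite !mxE eq_sym (negPf ml) expr0n mulr0.
Qed.

(** [newton_functional_ge0] applies to [l |-> U i l * U j l], its hypothesis on
    Newton products being the conclusion of [micchelli_willoughby]. *)
Theorem nonneg_derivs_preserves_DN (R : realType) N (h : R -> R) :
  nonneg_derivs N.+1 h -> h t @[t --> 0^'+] --> h 0 ->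
  preserves_DN N.+2 h.
Proof.
move=> nh h0 A [[sA A_psd] A_ge0].
have [U [lam dA]] := symmx_spectral_dec sA; have [oU AE lam_le] := dA.
have lam_ge0 i : (i < N.+2)%N -> 0 <= lam i.
  move=> iN; have := @DN_spectral_ge0 _ _ U (\row_(l < N.+2) lam l) oU.
  by rewrite -AE => /(_ (conj sA A_psd) (Ordinal iN)); rewrite mxE.
have h_gt0 (x : R) : 0 < x -> 0 <= h x by case: nh => + _; exact.
have h_ge0 (x : R) : 0 <= x -> 0 <= h x.
  rewrite le_eqVlt => /orP[/eqP <-|]; last exact: h_gt0.
  apply: cvgr_to_ge h0 _; near=> t; apply: h_gt0.
  by near: t; exact: nbhs_right_gt.
rewrite {1}AE matfunE //; split; first split.
- by rewrite !trmx_mul trmxK tr_diag_mx mulmxA.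
- move=> v; have := spectral_form U (map_mx h (\row_(l < N.+2) lam l)) v^T.
  rewrite trmxK => ->; apply: sumr_ge0 => l _.
  by rewrite mulr_ge0 ?sqr_ge0 // !mxE h_ge0 // lam_ge0.
move=> i j; have [D [D0 dD D_ge0 Dc]] := nonneg_derivs_chain nh.
pose c l := U i (inord l) * U j (inord l).
have := @newton_functional_ge0 _ N lam c D lam_le lam_ge0.
rewrite D0 spectral_mxE => L_ge0.
rewrite (eq_bigr (fun l : 'I_N.+2 => c l * h (lam l))) => [|l _]; last first.
  by rewrite /c inord_val !mxE mulrAC.
apply: L_ge0 => // k kN.
have := micchelli_willoughby dA (fun i j _ => A_ge0 i j) kN i j.
rewrite spectral_mxE; congr (_ <= _); apply: eq_bigr => l _.
by rewrite /c inord_val mxE mulrAC.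
Unshelve. all: by end_near.
Qed.

(** * Fractional powers of path matrices *)

Definition bidiag_mx (R : realType) n : 'M[R]_n :=
  \matrix_(i, j) ((j == i) || (j.+1 == i :> nat))%:R.

(** A tridiagonal matrix, nonnegative as a product of nonnegative matrices and
    positive semidefinite as a Gram matrix: walks from 0 need [k] steps to
    reach [k]. *)
Definition path_mx (R : realType) n : 'M[R]_n :=
  bidiag_mx R n *m (bidiag_mx R n)^T.

Lemma path_mx_DN (R : realType) n : DN n (path_mx R n).
Proof.
split; first split.
- by rewrite /path_mx trmx_mul trmxK.
- move=> v; pose w := (bidiag_mx R n)^T *m v.
  have -> : v^T *m path_mx R n *m v = w^T *m w.
    by rewrite /w /path_mx trmx_mul trmxK !mulmxA.
  by rewrite mxE sumr_ge0 // => i _; rewrite mxE -expr2 sqr_ge0.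
- move=> i j; rewrite mxE sumr_ge0 // => k _.
  by rewrite !mxE mulr_ge0 ?ler0n.
Qed.

Lemma path_mx_far (R : realType) n (i j : 'I_n) : (i.+1 < j)%N ->
  path_mx R n i j = 0.
Proof.
move=> ij; rewrite mxE big1 // => k _; rewrite !mxE -natrM mulnb.
rewrite -!(inj_eq val_inj) /=.
case: andP => // -[/orP[]/eqP ki /orP[]/eqP kj]; exfalso; lia.
Qed.

Lemma path_mx_next (R : realType) n (i j : 'I_n) : i.+1 = j ->
  path_mx R n i j = 1.
Proof.
move=> ij; rewrite mxE (bigD1 i) //= !mxE eqxx ij eqxx orbT mulr1 big1 ?addr0 //.
move=> k ki; rewrite !mxE -natrM mulnb.
move: ki; rewrite -!(inj_eq val_inj) /= => /eqP ki.
case: andP => // -[/orP[]/eqP ki' /orP[]/eqP kj]; exfalso; lia.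
Qed.

Lemma path_mx_exp (R : realType) n k (j : 'I_n.+1) : (k <= j)%N ->
  (path_mx R n.+1 ^+ k) 0 j = (k == j :> nat)%:R.
Proof.
elim: k j => [|k IHk] j kj.
  by rewrite expr0 mxE -(inj_eq val_inj).
rewrite exprSr mxE; have kn : (k < n.+1)%N by exact: ltn_trans (ltn_ord j).
rewrite (bigD1 (Ordinal kn)) //= IHk //= eqxx mul1r big1 ?addr0.
  move: kj; rewrite leq_eqVlt => /orP[/eqP kj|kj].
    by rewrite (path_mx_next _ (i := Ordinal kn)) // kj eqxx.
  by rewrite path_mx_far // ltn_eqF.
move=> i /negP ik; have [ki|ik'] := leqP k i; last first.
  by rewrite path_mx_far ?mulr0 // (leq_ltn_trans _ kj).
rewrite IHk // (_ : (k == i :> nat) = false) ?mul0r //.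
by apply/negP => /eqP ki'; apply: ik; apply/eqP/val_inj.
Qed.

Lemma spectral_exp (R : realType) n (A U : 'M[R]_n.+1) lam k :
  spectral_dec A U lam ->
  forall i j, (A ^+ k) i j = \sum_l U i l * lam l ^+ k * U j l.
Proof.
move=> [oU -> _]; have oU' : U^T *m U = 1%:M by exact: mulmx1C.
have -> : (U *m diag_mx (\row_(l < n.+1) lam l) *m U^T) ^+ k =
    U *m diag_mx (\row_(l < n.+1) lam l ^+ k) *m U^T.
  elim: k => [|k IHk].
    rewrite expr0 -[LHS]/(1%:M) -oU; congr (_ *m _); rewrite -[LHS]mulmx1.
    by congr (_ *m _); apply/matrixP => i j; rewrite !mxE expr0.
  rewrite exprSr IHk -[LHS]/(_ *m _) !mulmxA -(mulmxA _ U^T) oU' mulmx1.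
  rewrite -(mulmxA U) mulmx_diag; congr (_ *m diag_mx _ *m _).
  by apply/rowP => l; rewrite !mxE exprSr.
by move=> i j; rewrite spectral_mxE; apply: eq_bigr => l _; rewrite mxE.
Qed.

(** Only [k = n] contributes to the corner entry of a polynomial of degree at
    most [n], by [path_mx_exp]. *)
Lemma path_spectral_coef (R : realType) n (U : 'M[R]_n.+1) lam (q : {poly R}) :
  spectral_dec (path_mx R n.+1) U lam -> (size q <= n.+1)%N ->
  \sum_(l < n.+1) U 0 l * q.[lam l] * U ord_max l = q`_n.
Proof.
move=> dA qn; rewrite (eq_bigr (fun l : 'I_n.+1 => \sum_(k < n.+1)
    q`_k * (U 0 l * lam l ^+ k * U ord_max l))) => [|l _]; last first.
  rewrite (horner_coef_wide _ qn) mulr_sumr mulr_suml; apply: eq_bigr => k _; ring.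
rewrite exchange_big (eq_bigr (fun k : 'I_n.+1 => q`_k * (k == ord_max)%:R)) /=.
  rewrite (bigD1 ord_max) //= eqxx mulr1 big1 ?addr0 // => k /negPf ->.
  by rewrite mulr0.
move=> k _; rewrite -mulr_sumr -(spectral_exp _ dA) path_mx_exp ?leq_ord //.
Qed.

(** If two eigenvalues were equal, a monic polynomial of degree [n] would vanish
    on the spectrum, against [path_spectral_coef]. *)
Lemma path_spectral_lt (R : realType) n (U : 'M[R]_n.+1) lam :
  spectral_dec (path_mx R n.+1) U lam ->
  forall i j, (i < j < n.+1)%N -> lam i < lam j.
Proof.
move=> dA i j /andP[ij jn]; have [_ _ lam_le] := dA.
rewrite lt_neqAle lam_le ?(ltnW ij) // andbT; apply/negP => /eqP lamij.
pose q := \prod_(l < n) ('X - (lam (lift (Ordinal jn) l))%:P).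
have size_q : size q = n.+1.
  by rewrite size_prod_XsubC -[index_enum _]enumT size_enum_ord.
have := path_spectral_coef (q := q) dA; rewrite size_q leqnn => /(_ isT).
have /monicP := monic_prod_XsubC (index_enum 'I_n) xpredT
  (fun l => lam (lift (Ordinal jn) l)).
rewrite lead_coefE -/q size_q /= => ->.
have root_q (k : 'I_n.+1) : k != Ordinal jn -> q.[lam k] = 0.
  case: (unliftP (Ordinal jn) k) => [l ->|->]; last by rewrite eqxx.
  by move=> _; rewrite /q horner_prod (bigD1 l) //= !hornerE subrr mul0r.
rewrite big1 => [/eqP|l _]; first by rewrite eq_sym oner_eq0.
have [->|/root_q ->] := eqVneq l (Ordinal jn); last by rewrite mulr0 mul0r.
have ij0 : Ordinal (ltn_trans ij jn) != Ordinal jn.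
  by rewrite -(inj_eq val_inj) /= ltn_eqF.
by have := root_q _ ij0; rewrite /= lamij => ->; rewrite mulr0 mul0r.
Qed.

Lemma powR_deriv_chain (R : realType) (a : R) N :
  deriv_chain N (fun k x => (\prod_(i < k) (a - i%:R)) * x `^ (a - k%:R)).
Proof.
move=> k x _ x0; rewrite big_ord_recr /=.
apply: is_derive_eq.
  exact: is_deriveZ (is_derive1_powR (a - k%:R) x0).
by rewrite /GRing.scale /= mulrA -natr1 opprD addrA.
Qed.

(** On polynomials of degree at most [K.+2] the functional is the coefficient
    of ['X^K.+2]; hence on any function it is the divided difference over the
    spectrum, which has the sign of the derivative of that order. For
    [x `^ a] this is the sign of [a * (a - 1) * ... * (a - K.+1)]. *)
Lemma path_mx_powR_lt0 (R : realType) K (a : R) (U : 'M[R]_K.+3) lam :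
  K%:R < a < K.+1%:R -> spectral_dec (path_mx R K.+3) U lam ->
  \sum_(l < K.+3) U 0 l * lam l `^ a * U ord_max l < 0.
Proof.
move=> /andP[Ka aK] dA; have [oU AE _] := dA; have lam_lt := path_spectral_lt dA.
have [A_psd _] := path_mx_DN R K.+3.
have lam0 : 0 <= lam 0%N.
  have := @DN_spectral_ge0 _ _ U (\row_(l < K.+3) lam l) oU.
  by rewrite -AE => /(_ A_psd 0); rewrite mxE.
have a0 : 0 < a by apply: le_lt_trans Ka.
have [b bE] := newton_interpolation (fun x => x `^ a) lam_lt.
pose D k (x : R) := (\prod_(i < k) (a - i%:R)) * x `^ (a - k%:R).
have D0 x : D 0%N x = x `^ a by rewrite /D big_ord0 mul1r subr0.
have [|||||c /andP[lc _] cE] := @newton_coef_mvt R K.+1 D lam b.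
- exact: powR_deriv_chain.
- have -> : D 0%N = (fun x => x `^ a) by apply/funext.
  apply: nneg_within_continuous => //; last by apply: lam_lt; rewrite ltnSn.
    by rewrite powR0 ?gt_eqF //; exact: powR_cvg0.
  by move=> x x0; exact: is_derive_continuous (is_derive1_powR a x0).
- exact: lam0.
- by move=> i iK; apply: lam_lt; move: iK; lia.
- by move=> l lK; rewrite D0 bE.
rewrite (eq_bigr (fun l : 'I_K.+3 => \sum_(k < K.+3) b k *
    (U 0 l * newton lam k (lam l) * U ord_max l))) => [|l _]; last first.
  rewrite bE // mulr_sumr mulr_suml; apply: eq_bigr => k _; ring.
have LE (k : 'I_K.+3) :
    \sum_(l < K.+3) U 0 l * newton lam k (lam l) * U ord_max l = (k == ord_max)%:R.
  pose q := \prod_(m < k) ('X - (lam m)%:P).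
  have size_q : size q = k.+1.
    by rewrite size_prod_XsubC -[index_enum _]enumT size_enum_ord.
  rewrite (eq_bigr (fun l : 'I_K.+3 => U 0 l * q.[lam l] * U ord_max l)) => [|l _].
    rewrite (path_spectral_coef dA) ?size_q ?ltn_ord //.
    have [kE|kK] := eqVneq k ord_max.
      have /monicP := monic_prod_XsubC (index_enum 'I_k) xpredT (fun m => lam m).
      by rewrite lead_coefE -/q size_q kE.
    rewrite nth_default // size_q ltn_neqAle -ltnS ltn_ord andbT.
    by apply: contra kK => /eqP kE; apply/eqP/val_inj.
  by rewrite newton_horner.
rewrite exchange_big (eq_bigr (fun k : 'I_K.+3 => b k * (k == ord_max)%:R)) /=.
  rewrite (bigD1 ord_max) //= eqxx mulr1 big1 ?addr0 => [|k /negPf ->]; last first.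
    by rewrite mulr0.
  have f0 : 0 < (K.+2)`!%:R :> R by rewrite ltr0n fact_gt0.
  rewrite -(pmulr_llt0 _ f0) -cE /D big_ord_recr /= -mulrA pmulr_rlt0.
    by rewrite pmulr_llt0 ?subr_lt0 // powR_gt0 //; exact: le_lt_trans lc.
  apply: prodr_gt0 => i _; rewrite subr_gt0; apply: le_lt_trans Ka.
  by rewrite ler_nat -ltnS.
by move=> k _; rewrite -mulr_sumr LE.
Qed.

Lemma cvg_at_right0_scale (R : realType) (f : R -> R) (x : R) : 0 <= x ->
  f t @[t --> 0^'+] --> f 0 -> f (t * x) @[t --> 0^'+] --> f 0.
Proof.
rewrite le_eqVlt => /orP[/eqP <- _|x0 fc].
  by under eq_fun do rewrite mulr0; exact: cvg_cst.
apply/cvgrPdist_lt => e e0; have /cvgrPdist_lt/(_ e e0) := fc.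
rewrite !near_withinE => /nbhs_ballP[d /= d0 dP].
apply/nbhs_ballP; exists (d / x) => /=; first exact: divr_gt0.
move=> t; rewrite /ball /= sub0r normrN => td t0.
apply: (dP (t * x)); last exact: mulr_gt0.
by rewrite /ball /= sub0r normrN normrM (gtr0_norm x0) -ltr_pdivlMr.
Qed.

Lemma DN_scale (R : realType) n t (A : 'M[R]_n) : 0 <= t -> DN n A ->
  DN n (t *: A).
Proof.
move=> t0 [[sA A_psd] A_ge0]; split; first split.
- by rewrite linearZ /= sA.
- by move=> v; rewrite -scalemxAr -scalemxAl mxE mulr_ge0.
- by move=> i j; rewrite mxE mulr_ge0.
Qed.

(** Near 0 the function [f] is almost the constant [f 0 > 0], so small multiples
    of [path_mx] inherit the sign of [path_mx_powR_lt0]. *)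
Lemma pow_mul_not_preserves_DN (R : realType) K (a : R) (f : R -> R) :
  K%:R < a < K.+1%:R -> f t @[t --> 0^'+] --> f 0 -> 0 < f 0 ->
  ~ preserves_DN K.+3 (pow_mul a f).
Proof.
move=> Ka fc f0 pres; have [[sA A_psd] A_ge0] := path_mx_DN R K.+3.
have [U [lam dA]] := symmx_spectral_dec sA; have [oU AE lam_le] := dA.
have lam_ge0 (l : 'I_K.+3) : 0 <= lam l.
  have := @DN_spectral_ge0 _ _ U (\row_(l < K.+3) lam l) oU.
  by rewrite -AE => /(_ (conj sA A_psd) l); rewrite mxE.
pose S t := \sum_(l < K.+3) U 0 l * lam l `^ a * U ord_max l * f (t * lam l).
have S_ge0 t : 0 < t -> 0 <= S t.
  move=> t0; have [_ /(_ 0 ord_max)] :=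
    pres _ (DN_scale (ltW t0) (path_mx_DN R K.+3)).
  rewrite AE scalemxAl scalemxAr -linearZ /= matfunE // spectral_mxE.
  rewrite (eq_bigr (fun l : 'I_K.+3 => t `^ a *
    (U 0 l * lam l `^ a * U ord_max l * f (t * lam l)))) => [|l _].
    by rewrite -mulr_sumr pmulr_rge0 // powR_gt0.
  rewrite !mxE /pow_mul powRM ?(ltW t0) //; ring.
have S_cvg : S t @[t --> 0^'+] -->
    \sum_(l < K.+3) U 0 l * lam l `^ a * U ord_max l * f 0.
  apply: cvg_big => [|l _]; first exact: add_continuous.
  by apply: cvgMr; exact: cvg_at_right0_scale.
have : 0 <= \sum_(l < K.+3) U 0 l * lam l `^ a * U ord_max l * f 0.
  apply: cvgr_to_ge S_cvg _; near=> t; apply: S_ge0.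
  by near: t; exact: nbhs_right_gt.
by rewrite -mulr_suml pmulr_lge0 // leNgt (path_mx_powR_lt0 Ka dA).
Unshelve. all: by end_near.
Qed.

(** Pad a matrix of size [m] with a zero block; [h] acts blockwise. *)
Lemma preserves_DN_leq (R : realType) m n (h : R -> R) : (m <= n)%N ->
  preserves_DN n h -> preserves_DN m h.
Proof.
move=> /subnKC <-; move: (n - m)%N => p pres A [[sA A_psd] A_ge0].
have [U [lam [oU AE _]]] := symmx_spectral_dec sA.
pose A' : 'M[R]_(m + p) := block_mx A 0 0 0.
have DA' : DN (m + p) A'.
  split; first split.
  - by rewrite /A' tr_block_mx !trmx0 sA.
  - move=> v; rewrite -[v]vsubmxK /A' tr_col_mx mul_row_block !mulmx0 !addr0.
    by rewrite mul_row_col mul0mx addr0.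
  - move=> i j; rewrite /A'.
    case: (split_ordP i) => k ->; case: (split_ordP j) => l ->.
    + by rewrite block_mxEul.
    + by rewrite block_mxEur mxE.
    + by rewrite block_mxEdl mxE.
    + by rewrite block_mxEdr mxE.
pose d : 'rV[R]_(m + p) := row_mx (\row_(l < m) lam l) 0.
pose V : 'M[R]_(m + p) := block_mx U 0 0 1%:M.
have oV : orthogonalmx V.
  rewrite /orthogonalmx /V tr_block_mx !trmx0 trmx1 mulmx_block.
  by rewrite !mulmx0 !mul0mx mulmx1 !addr0 add0r oU -scalar_mx_block.
have VdV (e : 'rV[R]_m) e' :
    ulsubmx (V *m diag_mx (row_mx e e') *m V^T) = U *m diag_mx e *m U^T.
  rewrite /V diag_mx_row tr_block_mx !mulmx_block block_mxKul.
  by rewrite !mul0mx !mulmx0 !addr0 trmx0 mulmx0 addr0.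
have A'E : A' = V *m diag_mx d *m V^T.
  rewrite /A' /V /d diag_mx_row tr_block_mx !trmx0 trmx1 !mulmx_block.
  by rewrite !(mul0mx, mulmx0) !mulmx1 !mul1mx !addr0 !add0r mul0mx -AE linear0.
have -> : matfun h A = ulsubmx (matfun h A').
  by rewrite A'E AE !matfunE // map_row_mx VdV.
have [[sB B_psd] B_ge0] := pres _ DA'; split; first split.
- by rewrite trmx_ulsub sB.
- move=> v; have := B_psd (col_mx v 0).
  rewrite -{1}[matfun h A']submxK tr_col_mx mul_row_block trmx0 !mul0mx !addr0.
  by rewrite mul_row_col mulmx0 addr0.
- by move=> i j; rewrite !mxE.
Qed.

(** * The critical exponent *)

(** Every [t < n - 2] is followed by a noninteger exponent below [n - 2], where
    preservation fails; so no smaller [t] belongs to the set whose infimum is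
    taken. *)
Lemma critical_exponentE (R : realType) (n : nat) (f : R -> R) : (2 <= n)%N ->
  [set a : R | 0 <= a /\ preserves_DN n (pow_mul a f)] =
    [set k%:R | k in [set: nat]] `|` [set a : R | n%:R - 2 <= a] ->
  critical_exponent f n = (n%:R - 2)%:E.
Proof.
move=> hn /seteqP[sub sup]; have n2 : 0 <= n%:R - 2 :> R by rewrite subr_ge0 ler_nat.
apply/eqP; rewrite eq_le; apply/andP; split.
  apply: ereal_inf_lbound; exists (n%:R - 2) => //; split=> // A a DA na.
  by have [_] := sup a (or_intror na); exact.
apply: le_ereal_inf_tmp => _ [t [t0 tP] <-]; rewrite lee_fin leNgt; apply/negP => tn.
(* If [t] is an integer, [t + 1 / 2] is still below [n - 2]. *)
have [a /andP[ta an] aN] : exists2 a : R, t <= a < n%:R - 2 & forall k, k%:R <> a.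
  have [tT|tT] := eqVneq (Num.truncn t)%:R t; last first.
    exists t => [|k kt]; first by rewrite lexx.
    by move: tT; rewrite -kt natrK eqxx.
  have tn1 : ((Num.truncn t).+3 <= n)%N.
    by move: tn; rewrite -{1}tT ltrBrDr -natrD ltr_nat addn2.
  exists ((Num.truncn t)%:R + 2^-1) => [|k].
    rewrite {1}tT lerDl invr_ge0 ler0n /=.
    have : (Num.truncn t).+3%:R <= n%:R :> R by rewrite ler_nat.
    rewrite -3!natr1; lra.
  move/(congr1 (fun x => x * 2)); rewrite mulrDl mulVf ?pnatr_eq0 //.
  rewrite -!natrM natr1 => /eqP; rewrite eqr_nat => /eqP; lia.
have [|[k _ /aN]//|] := sub a; last by rewrite /= leNgt an.
split; first exact: le_trans ta.
by move=> A DA; exact: tP.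
Qed.

Theorem theorem3p1 (R : realType) (n : nat) (f : R -> R) (f0 : R) (M : nat -> R)
  (hn : (2 <= n)%N)
  (f_ge0 : forall x : R, 0 <= x -> 0 <= f x)
  (f_C : class_C_nneg n.-1 f)
  (f_gt0 : forall x : R, 0 < x -> 0 < f x)
  (f_lim0 : f x @[x --> 0^'+] --> f0)
  (f0_gt0 : 0 < f0)
  (df_ge0 : forall i : nat, (0 < i < n)%N ->
    forall x : R, 0 < x -> 0 <= derive1n i f x)
  (df_lim0 : forall i : nat, (0 < i < n)%N ->
    derive1n i f x @[x --> 0^'+] --> M i) :
  [set alpha : R | 0 <= alpha /\ preserves_DN n (pow_mul alpha f)] =
    [set k%:R | k in [set: nat]] `|` [set alpha : R | n%:R - 2 <= alpha]
  /\ critical_exponent f n = (n%:R - 2)%:E.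
Proof.
have fc := class_C_right_continuous f_C.
have ff0 : f 0 = f0 by exact: cvg_unique fc f_lim0.
suff E : [set alpha : R | 0 <= alpha /\ preserves_DN n (pow_mul alpha f)] =
    [set k%:R | k in [set: nat]] `|` [set alpha : R | n%:R - 2 <= alpha].
  by split=> //; exact: critical_exponentE.
apply/seteqP; split=> [a [a0 pres]|a aP].
  have [aT|aT] := eqVneq (Num.truncn a)%:R a; first by left; exists (Num.truncn a).
  right; rewrite /= leNgt; apply/negP => an.
  have /andP[Ta aT1] := truncn_itv a0.
  have Kn : ((Num.truncn a).+3 <= n)%N.
    have : (Num.truncn a)%:R + 2 < n%:R :> R by lra.
    by rewrite -natrD ltr_nat addn2.
  apply: (@pow_mul_not_preserves_DN _ (Num.truncn a) a f) => //; last first.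
  - exact: preserves_DN_leq pres.
  - by rewrite ff0.
  - by rewrite lt_neqAle aT Ta.
have n2 : 0 <= n%:R - 2 :> R by rewrite subr_ge0 ler_nat.
have a0 : 0 <= a by case: aP => [[k _ <-] //|]; exact: le_trans.
split=> //; have nE : n = n.-2.+2 by case: n hn {f_C df_ge0 df_lim0 aP n2} => [|[]].
rewrite nE; apply: nonneg_derivs_preserves_DN; last exact: pow_mul_right_continuous.
have -> : n.-2.+1 = n.-1 by rewrite [in RHS]nE.
apply: nonneg_derivsM; last first.
  apply: class_C_nonneg_derivs => // i /andP[i0 iN]; apply: df_ge0.
  by rewrite i0 /= nE ltnS; move: iN; rewrite [in n.-1]nE.
apply: nonneg_derivs_powR; case: aP => [[k _ <-]|na]; first by left; exists k.
right; have -> : n.-1%:R = n%:R - 1 :> R by rewrite [in RHS]nE -natr1 addrK [in LHS]nE.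
by move: na => /=; lra.
Qed.
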